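(* Let $r>0$ and $T>0$, and let $C_T=\int_0^T|W^r_t|\,dt$ be the absolute area of reset Brownian motion with reset rate $r$. Its mean and variance are given by $$\mathbb{E}_r[C_T]=T^{3/2}f_1(rT),\qquad \mathbb{V}\mathrm{ar}_r[C_T]=T^3f_2(rT),$$ where, for $\rho>0$, $$f_1(\rho)=\frac{1}{\sqrt{2\pi}}\left[\frac{e^{-\rho}}{\rho}+\frac{\sqrt{\pi}}{2\rho^{3/2}}(2\rho-1)\,\mathrm{erf}(\sqrt{\rho})\right]$$ and $$f_2(\rho)=\frac{1}{8\pi\rho^3}\left[2\pi\left(2\rho^2+\rho-6+(5\rho+6)e^{-\rho}\right)-\left(2\sqrt{\rho}\,e^{-\rho}+\sqrt{\pi}(2\rho-1)\,\mathrm{erf}(\sqrt{\rho})\right)^2\right].$$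
   Context: Reset Brownian motion (rBM): given a Poisson process on $[0,\infty)$ of intensity $r>0$, the process $(W^r_t)_{t\ge 0}$ starts at $0$, evolves as a standard Brownian motion on $\mathbb{R}$, and at each Poisson point is placed back at $0$, from where it continues as a fresh standard Brownian motion started at $0$; the successive Brownian pieces are independent of each other and of the Poisson process. $\mathbb{E}_r$ and $\mathbb{V}\mathrm{ar}_r$ denote expectation and variance for rBM with rate $r$, and $\mathrm{erf}(x)=\frac{2}{\sqrt\pi}\int_0^x e^{-u^2}du$. *)

(* Defs.v *)
From HB Require Import structures.
From mathcomp Require Import all_boot all_order all_algebra finmap.
From mathcomp Require Import all_classical all_reals all_analysis.

Set Implicit Arguments.
Unset Strict Implicit.
Unset Printing Implicit Defensive.

Import Order.TTheory GRing.Theory Num.Theory.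
Import numFieldNormedType.Exports.

Local Open Scope classical_set_scope.
Local Open Scope ring_scope.

Section independence.
Context d (Omega : measurableType d) (R : realType) (P : probability Omega R).

Definition mutually_independent (I : choiceType)
    (F : I -> set (set Omega)) : Prop :=
  forall (J : {fset I}) (A : I -> set Omega),
    (forall i, i \in J -> F i (A i)) ->
    P (\bigcap_(i in [set` J]) A i) = (\prod_(i <- J) P (A i))%E.

Definition rv_sigma_algebra d' (E : measurableType d') (X : Omega -> E) :
    set (set Omega) :=
  preimage_set_system setT X measurable.

(* A stochastic process is a family indexed by R of which only the times
   t >= 0 are ever constrained or used. *)
Definition process_sigma_algebra d' (E : measurableType d')
    (X : R -> Omega -> E) : set (set Omega) :=
  <<s \bigcup_(t in [set t | 0 <= t]) rv_sigma_algebra (X t) >>.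

(* An infinite nondecreasing sequence of times covers every finite one
   t_0 <= ... <= t_n (repeat t_n), and conversely mutual independence only
   concerns finite subfamilies. *)
Definition independent_increments (X : R -> Omega -> R) : Prop :=
  forall t : nat -> R, 0 <= t 0%N -> nondecreasing_seq t ->
    mutually_independent
      (fun i => rv_sigma_algebra (fun w => X (t i.+1) w - X (t i) w)).

End independence.

Section processes.
Context d (Omega : measurableType d) (R : realType) (P : probability Omega R).

(* The second argument of normal_prob is the standard deviation. *)
Record brownian_motion (B : R -> {RV P >-> R}) : Prop := BrownianMotion {
  brownian_init : {ae P, forall w, B 0 w = 0} ;
  brownian_increments : independent_increments P (fun t w => B t w) ;
  brownian_gaussian : forall s t : R, 0 <= s -> s < t ->
    forall A : set R, measurable A ->
      P [set w | A (B t w - B s w)] = normal_prob 0 (Num.sqrt (t - s)) A ;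
  brownian_continuous :
    {ae P, forall w, {within `[0, +oo[, continuous (fun t : R => B t w)}} }.

(* N t is the number of points in ]0, t]. *)
Record poisson_process (r : R) (N : R -> {RV P >-> nat}) : Prop :=
  PoissonProcess {
  poisson_init : {ae P, forall w, N 0 w = 0%N} ;
  poisson_increments :
    independent_increments P (fun t w => (N t w)%:R : R) ;
  poisson_law : forall s t : R, 0 <= s -> s < t -> forall k : nat,
    P [set w | N t w = (N s w + k)%N] = (poisson_pmf (r * (t - s)) k)%:E ;
  poisson_nondecreasing : {ae P, forall w, forall s t : R,
    0 <= s -> s <= t -> (N s w <= N t w)%N} ;
  poisson_right_continuous : {ae P, forall w, forall t : R, 0 <= t ->
    \forall u \near t^'+, N u w = N t w} }.

(* The n-th Poisson point for n >= 1, and 0 for n = 0. *)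
Definition poisson_point (N : R -> {RV P >-> nat}) (n : nat) (w : Omega) : R :=
  inf [set t | 0 <= t /\ (n <= N t w)%N].

(* B n is the Brownian piece run after the n-th reset (B 0 before any reset). *)
Record reset_inputs (r : R) (N : R -> {RV P >-> nat})
    (B : nat -> R -> {RV P >-> R}) : Prop := ResetInputs {
  reset_poisson : poisson_process r N ;
  reset_brownian : forall n, brownian_motion (B n) ;
  reset_independent : mutually_independent P (fun i : option nat =>
    if i is Some n then process_sigma_algebra (fun t w => B n t w)
    else process_sigma_algebra (fun t w => N t w)) }.

Definition rBM (N : R -> {RV P >-> nat}) (B : nat -> R -> {RV P >-> R})
    (t : R) (w : Omega) : R :=
  B (N t w) (t - poisson_point N (N t w) w) w.

Definition absolute_area (W : R -> Omega -> R) (T : R) (w : Omega) : R :=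
  \int[lebesgue_measure]_(t in `[0, T]) `|W t w|.

End processes.

Section formulas.
Context {R : realType}.
Implicit Types x rho : R.

Definition erf x : R :=
  2 / Num.sqrt pi * \int[lebesgue_measure]_(u in `[0, x]) expR (- u ^+ 2).

Definition f1 rho : R :=
  1 / Num.sqrt (2 * pi) *
  (expR (- rho) / rho
   + Num.sqrt pi / (2 * rho `^ (3 / 2)) * (2 * rho - 1) * erf (Num.sqrt rho)).

Definition f2 rho : R :=
  1 / (8 * pi * rho ^+ 3) *
  (2 * pi * (2 * rho ^+ 2 + rho - 6 + (5 * rho + 6) * expR (- rho))
   - (2 * Num.sqrt rho * expR (- rho)
      + Num.sqrt pi * (2 * rho - 1) * erf (Num.sqrt rho)) ^+ 2).

End formulas.

(* Main.v *)
(* Conditionally on the Poisson process, |W_t| is the modulus of a Brownian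
   motion run for the age a_t = t - (last reset before t), so
   E|W_t| = sqrt(2/pi) E sqrt(a_t).  For s < t, either no reset separates s
   and t, and E|W_s W_t| is the product moment E|B_a B_(a+h)| with a = a_s and
   h = t - s, or a reset does and the two moduli are conditionally independent.
   Since {a_t >= x} is the event that ]t - x, t] contains no Poisson point, the
   layer-cake formula sqrt a = |{y >= 0 : y^2 <= a}| expresses both expectations
   as integrals of explicit densities against e^(-r y^2) over 0 <= y <= sqrt s.
   Integrating over 0 <= s <= t <= T and substituting h = u - y^2 turns the
   inner integrals into multiples of u e^(-r u) and of its primitive, whence
   E C_T^2.

   Neither rBM nor its area is known to be measurable on Omega, so every
   expectation is computed on a measurable version that is almost surely equal
   to it: a process that is right continuous at t is recovered as the upper
   limit of its values on finer and finer grids. *)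
From HB Require Import structures.
Require Import Defs.
From mathcomp Require Import all_boot all_order all_algebra finmap.
From mathcomp Require Import all_classical all_reals all_analysis.
From mathcomp Require Import measurable_realfun ring lra.

Set Implicit Arguments.
Unset Strict Implicit.
Unset Printing Implicit Defensive.

Import Order.TTheory GRing.Theory Num.Theory.
Import numFieldNormedType.Exports.

Local Open Scope classical_set_scope.
Local Open Scope ring_scope.

(** * Nonnegative integrals and jointly measurable versions *)

(** All moments are computed in the nonnegative extended reals, where Tonelli's theorem asks for
    measurability but not for integrability; finiteness is read off from the value found.

    The substitution u = h + y^2 is what makes the second moment elementary. For a common piece it
    merges the exponentials into e^(-r u), which leaves the inner integral; for distinct pieces a
    second such shift, of the variable inside the density, has the same effect. What remains is
    homogeneous, so its integral over 0 <= y <= sqrt u is a constant times u: 9/8 for the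
    product-moment kernel, which there reduces to an arcsine, and pi/4, a quarter of the unit disc,
    for distinct pieces, before prefactors. Hence [erf] enters the variance only through the squared
    mean.

    The running piece has a random index and is evaluated at a random age. Splitting along the
    values of the counting process fixes the index. For the age, the Poisson process and the pieces
    are taken as random elements of spaces with their own sigma-algebras, so that independence
    becomes iterated integration. *)

Section ae_integrals.
Local Open Scope ereal_scope.
Context d (T : measurableType d) (R : realType) (mu : {measure set T -> \bar R}).
Import HBNNSimple.

(* No measurability is assumed: a nonnegative integral is a supremum over
   simple minorants, which may be cut off on a negligible set. *)
Lemma ge0_integral_ae_eq (f g : T -> \bar R) :
  (forall x, 0 <= f x) -> (forall x, 0 <= g x) ->
  {ae mu, forall x, f x = g x} -> \int[mu]_x f x = \int[mu]_x g x.
Proof.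
suff H (f' g' : T -> \bar R) : (forall x, 0 <= f' x) -> (forall x, 0 <= g' x) ->
    {ae mu, forall x, f' x = g' x} -> \int[mu]_x f' x <= \int[mu]_x g' x.
  move=> f0 g0 fg; apply/eqP; rewrite eq_le H//= H//.
  by apply: filterS fg => x ->.
move=> f0 g0 [N [mN N0 Nfg]].
rewrite !ge0_integralTE//; apply: ge_ereal_sup => _ [h /= hf <-].
apply: ereal_sup_ubound => /=.
exists (mul_nnsfun h (indic_nnsfun R (measurableC mN))).
  move=> x; rewrite (_ : mul_nnsfun _ _ x = h x * \1_(~` N) x)%R// indicE.
  have [xN|xN] := boolP (x \in ~` N); last by rewrite mulr0 g0.
  rewrite mulr1 (le_trans (hf x))//.
  suff -> : f' x = g' x by [].
  by apply: contrapT => fgx; move: xN; rewrite inE; apply; exact: Nfg.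
rewrite -!integralT_nnsfun; apply: ae_eq_integral => //.
- exact/measurable_EFinP/measurable_funP.
- exact/measurable_EFinP/measurable_funP.
- exists N; split => // x /= /not_implyP[_].
  apply: contra_notP => xN.
  by rewrite mindicE mem_set// mulr1.
Qed.

(** Applied with X the counting process at a fixed time: on each fibre the index of the running
    piece is constant, and independence can be used. *)
Lemma ge0_integral_fibers (X : T -> nat) (D : set T) (f g : T -> \bar R) :
  measurable D -> (forall n, measurable (X @^-1` [set n])) ->
  measurable_fun D f -> measurable_fun D g ->
  (forall x, D x -> 0 <= f x) -> (forall x, D x -> 0 <= g x) ->
  (forall n, \int[mu]_(x in D `&` X @^-1` [set n]) f x =
             \int[mu]_(x in D `&` X @^-1` [set n]) g x) ->
  \int[mu]_(x in D) f x = \int[mu]_(x in D) g x.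
Proof.
move=> mD mX mf mg f0 g0 fg.
have UD : D = \bigcup_n (D `&` X @^-1` [set n]).
  rewrite -setI_bigcupr; apply/seteqP; split => [x Dx|x []//].
  by split => //; exists (X x).
have tD : trivIset setT (fun n => D `&` X @^-1` [set n]).
  by move=> i j _ _ [x [[_ /= <-] [_ /= <-]]].
have mDX n : measurable (D `&` X @^-1` [set n]) by exact: measurableI.
rewrite UD !ge0_integral_bigcup//= -?UD//.
by apply: eq_eseriesr => n _; exact: fg.
Qed.

End ae_integrals.

Section rc_version.
Context (R : realType).

(** The successor in the numerator makes the grid point strictly larger than u, as a right limit
    requires. *)
Definition rgrid (m : nat) (u : R) : R :=
  (Num.truncn (u * m.+1%:R)).+1%:R / m.+1%:R.

Lemma rgrid_gt m u : u < rgrid m u.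
Proof. by rewrite /rgrid ltr_pdivlMr// truncnS_gt. Qed.

Lemma rgrid_le m u : 0 <= u -> rgrid m u <= u + m.+1%:R^-1.
Proof.
move=> u0; rewrite /rgrid ler_pdivrMr// mulrDl mulVf// -natr1 lerD2r.
by rewrite truncn_le// mulr_ge0.
Qed.

Lemma rgrid_cvg u : 0 <= u -> rgrid m u @[m --> \oo] --> u.
Proof.
move=> u0; apply: (@squeeze_cvgr _ _ _ _ (cst u) (fun m => u + m.+1%:R^-1)).
- by near=> m; rewrite /= ltW ?rgrid_gt//= rgrid_le.
- exact: cvg_cst.
- rewrite -[X in _ --> X]addr0; apply: cvgD; first exact: cvg_cst.
  exact: cvg_harmonic.
Unshelve. all: by end_near. Qed.

Lemma measurable_truncn : measurable_fun setT (@Num.truncn R).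
Proof.
move=> _ B _; rewrite setTI.
have -> : @Num.truncn R @^-1` B = \bigcup_(k in B) (@Num.truncn R @^-1` [set k]).
  apply/seteqP; split => [x Bx|x [k Bk] /= xk]; first by exists (Num.truncn x).
  by rewrite /preimage/= xk.
apply: bigcup_measurable => k _; case: k => [|k].
  rewrite (_ : _ @^-1` _ = `]-oo, 1[%classic)//; apply/seteqP; split => x /=.
    by move=> x0; rewrite in_itv/= (_ : 1 = 1%:R)// -truncn_le_nat x0.
  by rewrite in_itv/= (_ : 1 = 1%:R)// -truncn_le_nat leqn0 => /eqP.
rewrite (_ : _ @^-1` _ = `[k.+1%:R, k.+2%:R[%classic)//; apply/seteqP; split => x /=.
  by move=> xk; rewrite in_itv/= -truncn_le_nat -truncn_gt_nat xk !leqnn.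
rewrite in_itv/= -truncn_le_nat -truncn_gt_nat => /andP[? ?].
by apply/eqP; rewrite eqn_leq; apply/andP.
Qed.

(* A jointly measurable version of a right-continuous process, obtained by
   sampling it strictly to the right of each time. *)
Definition rc_version (T : Type) (X : R -> T -> \bar R) (p : R * T) : \bar R :=
  limn_esup (fun m => X (rgrid m p.1) p.2).

Lemma measurable_rc_version d (T : measurableType d) (X : R -> T -> \bar R) :
  (forall t, 0 <= t -> measurable_fun setT (X t)) ->
  measurable_fun setT (rc_version X).
Proof.
move=> mX; apply: measurable_fun_limn_esup => m.
(* The m-th sample depends on time only through the integer k, so on each strip [E k] it is the
   process at one fixed time. *)
pose E k : set (R * T) := [set p | Num.truncn (p.1 * m.+1%:R) = k].
have mE k : measurable (E k).
  have mp : measurable_fun setT (fun p : R * T => Num.truncn (p.1 * m.+1%:R)).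
    apply: (measurableT_comp measurable_truncn).
    by apply: measurable_funM => //; exact: measurable_fst.
  by rewrite -[E k]setTI; exact: (mp measurableT [set k]).
have -> : [set: R * T] = \bigcup_k E k.
  by apply/seteqP; split => // p _; exists (Num.truncn (p.1 * m.+1%:R)).
apply/(measurable_fun_bigcup _ mE) => k.
apply: (eq_measurable_fun (X (k.+1%:R / m.+1%:R) \o snd)).
  by move=> p; rewrite inE /E/= /rgrid => <-.
apply: measurable_funTS; apply: measurableT_comp => //.
by apply: mX; rewrite divr_ge0.
Qed.

Lemma rc_versionE (T : Type) (X : R -> T -> \bar R) t w : 0 <= t ->
  X u w @[u --> t^'+] --> X t w -> rc_version X (t, w) = X t w.
Proof.
move=> t0 Xt; rewrite /rc_version/=.
suff H : X (rgrid m t) w @[m --> \oo] --> X t w.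
  by rewrite is_cvg_limn_esupE; [exact/cvg_lim|apply/cvg_ex; exists (X t w)].
apply: cvg_trans Xt => A /= [e e0 eA].
have /cvgrPdist_lt/(_ _ e0) := rgrid_cvg t0.
by apply: filterS => m me; apply: eA => //=; exact: rgrid_gt.
Qed.

End rc_version.

(** * Independence of three random elements as iterated integration *)

Section independent_triple.
Local Open Scope ereal_scope.
Context d d0 d1 d2 (Omega : measurableType d) (E0 : measurableType d0)
  (E1 : measurableType d1) (E2 : measurableType d2) (R : realType)
  (P : probability Omega R).

(** Both sides are finite measures in C that agree on rectangles, a pi-system. Keeping D as a
    restriction reduces the independence of three elements to a product of two laws. *)
Lemma restricted_product_law (D : set Omega) (Y : {RV P >-> E1})
    (Z : {RV P >-> E2}) :
  measurable D ->
  (forall B C, measurable B -> measurable C ->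
    P (D `&` (Y @^-1` B `&` Z @^-1` C)) =
    P D * (P (Y @^-1` B) * P (Z @^-1` C))) ->
  forall C, measurable C ->
    P (D `&` (fun w => (Y w, Z w)) @^-1` C) =
    P D * (distribution P Y \x distribution P Z) C.
Proof.
move=> mD PD C mC.
have mYZ : measurable_fun setT (fun w => (Y w, Z w)) by exact/measurable_fun_pair.
pose YZ : {mfun Omega >-> (E1 * E2)%type} := HB.pack (fun w => (Y w, Z w))
  (isMeasurableFun.Build _ _ _ _ _ mYZ).
have fPD : P D \is a fin_num by exact: fin_num_measure.
pose c : {nonneg R} := NngNum (fine_ge0 (measure_ge0 P D)).
pose m1 := pushforward (mrestr P mD) YZ.
pose m2 := mscale c (distribution P Y \x distribution P Z).
pose G : set (set (E1 * E2)) :=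
  [set C | exists A, measurable A /\ exists B, measurable B /\ C = A `*` B].
have -> : P D * (distribution P Y \x distribution P Z) C = m2 C.
  by rewrite /m2 /mscale/= fineK.
rewrite setIC; apply: (@measure_unique _ R _ G (fun=> setT) _ _ _ _ m1 m2) => //.
- rewrite measurable_prod_measurableType //; congr (<<s _ >>).
  rewrite predeqE; split => [[A mA [B mB <-]]|[A [mA [B [mB ->]]]]].
    by exists A; split => //; exists B.
  by exists A => //; exists B.
- move=> /= _ _ [X1 [mX1 [X2 [mX2 ->]]]] [Y1 [mY1 [Y2 [mY2 ->]]]].
  rewrite -setXI; exists (X1 `&` Y1); split; first exact: measurableI.
  by exists (X2 `&` Y2); split => //; exact: measurableI.
- by move=> _; exists setT; split => //; exists setT; split => //; rewrite setXTT.
- by rewrite bigcup_const.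
- move=> _ [A [mA [B [mB ->]]]].
  transitivity ((fine (P D))%:E * (distribution P Y \x distribution P Z) (A `*` B)) => //.
  by rewrite fineK// product_measure1E//= -PD// setIC.
- move=> _; rewrite [X in X < _](_ : _ = P (YZ @^-1` setT `&` D))//.
  rewrite preimage_setT setTI; exact: le_lt_trans (probability_le1 P mD) (ltry _).
Qed.

(** The law of the triple is the product of the three laws, by uniqueness on rectangles, and
    Tonelli's theorem, applied twice, splits the integral. Stated with integrals against P itself,
    so that [w1] and [w2] act as independent copies of the outcome. *)
Lemma independent_triple_integral (X : {RV P >-> E0}) (Y : {RV P >-> E1})
    (Z : {RV P >-> E2}) (F : E0 * (E1 * E2) -> \bar R) :
  (forall A B C, measurable A -> measurable B -> measurable C ->
    P (X @^-1` A `&` (Y @^-1` B `&` Z @^-1` C)) =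
    P (X @^-1` A) * (P (Y @^-1` B) * P (Z @^-1` C))) ->
  measurable_fun setT F -> (forall p, 0 <= F p) ->
  \int[P]_w F (X w, (Y w, Z w)) =
  \int[P]_w \int[P]_w1 \int[P]_w2 F (X w, (Y w1, Z w2)).
Proof.
move=> PXYZ mF F0.
have mYZ : measurable_fun setT (fun w => (Y w, Z w)) by exact/measurable_fun_pair.
have mXYZ : measurable_fun setT (fun w => (X w, (Y w, Z w))).
  exact/measurable_fun_pair.
pose XYZ : {mfun Omega >-> (E0 * (E1 * E2))%type} := HB.pack (fun w => (X w, (Y w, Z w)))
  (isMeasurableFun.Build _ _ _ _ _ mXYZ).
rewrite -(@ge0_integral_distribution _ _ _ _ _ P XYZ)//.
pose D2 : probability (E1 * E2)%type R :=
  distribution P Y \x distribution P Z.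
rewrite (@eq_measure_integral _ _ _ _ (distribution P X \x D2)); last first.
  move=> A mA _; apply/esym/product_measure_unique => // {mA}A B mA mB.
  rewrite -restricted_product_law//.
  - by rewrite -[X in measurable X]setTI; exact: measurable_funP.
  - move=> B' C' mB' mC'; exact: PXYZ.
rewrite fubini_tonelli1//= ge0_integral_distribution//; last 2 first.
- exact: measurable_fun_fubini_tonelli_F.
- by move=> x; apply: integral_ge0.
apply: eq_integral => w _; rewrite /= /fubini_F.
have mFw : measurable_fun setT (fun y => F (X w, y)).
  by apply: measurableT_comp => //; exact: measurable_pair1.
rewrite fubini_tonelli1//= ge0_integral_distribution//; last 2 first.
- exact: measurable_fun_fubini_tonelli_F.
- by move=> x; apply: integral_ge0.
apply: eq_integral => w1 _; rewrite /= /fubini_F ge0_integral_distribution//.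
apply: (measurableT_comp mFw); exact: measurable_pair1.
Qed.

End independent_triple.

(** * Tonelli over regions and affine substitutions *)

Section lebesgue_tools.
Local Open Scope ereal_scope.

Lemma measurable_integral_section d1 d2 (T1 : measurableType d1)
    (T2 : measurableType d2) (R : realType)
    (m2 : {sigma_finite_measure set T2 -> \bar R}) (B : T1 -> set T2)
    (f : T1 * T2 -> \bar R) :
  measurable [set p | B p.1 p.2] -> measurable_fun setT f -> (forall p, 0 <= f p) ->
  measurable_fun setT (fun x => \int[m2]_(y in B x) f (x, y)).
Proof.
move=> mS mf f0; pose S := [set p | B p.1 p.2]; pose g := f \_ S.
have mg : measurable_fun setT g.
  by apply/(measurable_restrictT _ _).1 => //; exact: measurable_funTS.
have g0 p : 0 <= g p by rewrite /g /patch; case: ifPn.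
rewrite (_ : (fun x => _) = fubini_F m2 g).
  exact: measurable_fun_fubini_tonelli_F.
apply/funext => x; rewrite integral_mkcond; apply: eq_integral => y _.
by rewrite /g /patch; congr (if _ then _ else _); apply/idP/idP; rewrite !inE.
Qed.

(** The region is given by its sections in either direction; restricting the integrand to it turns
    both sides into integrals over the whole product. *)
Lemma tonelli_swap d1 d2 (T1 : measurableType d1) (T2 : measurableType d2)
    (R : realType) (m1 : {sigma_finite_measure set T1 -> \bar R})
    (m2 : {sigma_finite_measure set T2 -> \bar R})
    (A : set T1) (B : T1 -> set T2) (C : set T2) (D : T2 -> set T1)
    (f : T1 * T2 -> \bar R) :
  (forall x y, A x /\ B x y <-> C y /\ D y x) ->
  measurable [set p | A p.1 /\ B p.1 p.2] ->
  measurable_fun setT f -> (forall p, 0 <= f p) ->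
  \int[m1]_(x in A) \int[m2]_(y in B x) f (x, y) =
  \int[m2]_(y in C) \int[m1]_(x in D y) f (x, y).
Proof.
move=> ABCD mS mf f0; pose S := [set p | A p.1 /\ B p.1 p.2].
pose g := f \_ S.
have mg : measurable_fun setT g.
  by apply/(measurable_restrictT _ _).1 => //; exact: measurable_funTS.
have g0 p : 0 <= g p by rewrite /g /patch; case: ifPn.
rewrite integral_mkcond [RHS]integral_mkcond.
transitivity (\int[m1]_x \int[m2]_y g (x, y)); last rewrite (fubini_tonelli g)//.
- apply: eq_integral => x _; rewrite /patch; case: ifPn => xA.
    rewrite integral_mkcond; apply: eq_integral => y _; rewrite /g /S /patch.
    have [yB|yB] := boolP (y \in B x).
      by rewrite mem_set//; split; exact: set_mem.
    by move: yB; rewrite notin_setE => yB; rewrite memNset//= => -[_ /yB].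
  rewrite integral0_eq// => y _; rewrite /g /patch memNset// => -[/= Ax _].
  by move: xA; rewrite notin_setE.
- apply: eq_integral => y _; rewrite /patch; case: ifPn => yC.
    rewrite [RHS]integral_mkcond; apply: eq_integral => x _; rewrite /g /S /patch.
    have [yB|yB] := boolP (x \in D y).
      by rewrite mem_set//; apply/ABCD; split; exact: set_mem.
    by move: yB; rewrite notin_setE => yB; rewrite memNset//= => /ABCD[_ /yB].
  rewrite [LHS]integral0_eq// => x _; rewrite /g /patch memNset// => /ABCD[/= Cy _].
  by move: yC; rewrite notin_setE.
Qed.

Context {R : realType}.
Local Notation mu := (@lebesgue_measure R).

(** The image of [mu] under x |-> c + k x, multiplied by |k|, agrees with [mu] on half-open
    intervals, hence everywhere. A negative k only changes which end of the preimage interval is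
    open. *)
Lemma lebesgue_affine (c k : R) (f : R -> \bar R) : k != 0%R ->
  measurable_fun setT f -> (forall x, 0 <= f x) ->
  \int[mu]_x f x = `|k|%:E * \int[mu]_x f (c + k * x)%R.
Proof.
move=> k0 mf f0; pose phi0 (x : measurableTypeR R) : measurableTypeR R := (c + k * x)%R.
have mphi : measurable_fun setT phi0.
  by apply: measurable_funD => //; exact: measurable_funM.
pose phi : {mfun measurableTypeR R >-> measurableTypeR R} :=
  HB.pack phi0 (isMeasurableFun.Build _ _ _ _ _ mphi).
pose ka : {nonneg R} := NngNum (normr_ge0 k).
pose pm : {measure set (measurableTypeR R) -> \bar R} :=
    measure_function_pushforward__canonical__measure_function_Measure mu mphi.
pose m := mscale ka pm.
transitivity (\int[m]_x f x).
  apply: eq_measure_integral => A mA _.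
  apply: (@lebesgue_measure_unique _ m) => // _ [[a b]] _ <-.
  rewrite [RHS](_ : _ = `|k|%:E * mu (phi @^-1` `]a, b]))//.
  have [kp|kn] := ltP 0%R k.
    rewrite (_ : phi @^-1` _ = `]((a - c) / k)%R, ((b - c) / k)%R]%classic); last first.
      apply/seteqP; split => x; rewrite /phi /phi0 /= !in_itv/= ltr_pdivrMr// ler_pdivlMr//;
        rewrite ltrBlDl lerBrDl mulrC//.
    rewrite !lebesgue_measure_itv/= !lte_fin ltr_pM2r ?invr_gt0// ltrD2r gtr0_norm//.
    case: ifPn => _; last by rewrite mule0.
    by rewrite -!EFinB -EFinM; congr EFin; field; rewrite gt_eqF.
  have {}kn : (k < 0)%R by rewrite lt_neqAle k0.
  rewrite (_ : phi @^-1` _ = `[((b - c) / k)%R, ((a - c) / k)%R[%classic); last first.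
    apply/seteqP; split => x; rewrite /phi /phi0 /= !in_itv/= ltr_ndivlMr// ler_ndivrMr//;
      rewrite ltrBlDl lerBrDl mulrC andbC//.
  rewrite !lebesgue_measure_itv/= !lte_fin ltr_nM2r ?invr_lt0// ltrD2r ltr0_norm//.
  case: ifPn => _; last by rewrite mule0.
  by rewrite -!EFinB -EFinM; congr EFin; field; rewrite lt_eqF.
rewrite ge0_integral_mscale//; congr (_ * _).
by rewrite ge0_integral_pushforward.
Qed.

Lemma lebesgue_affine_set (c k : R) (f : R -> \bar R) (D E : set R) : k != 0%R ->
  measurable D -> (forall x, D (c + k * x)%R <-> E x) ->
  measurable_fun setT f -> (forall x, 0 <= f x) ->
  \int[mu]_(x in D) f x = `|k|%:E * \int[mu]_(x in E) f (c + k * x)%R.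
Proof.
move=> k0 mD DE mf f0; rewrite integral_mkcond (lebesgue_affine c k0)//.
- rewrite [in RHS]integral_mkcond; congr (_ * _); apply: eq_integral => x _.
  rewrite /patch; congr (if _ then _ else _).
  by apply/idP/idP; rewrite !inE => /DE.
- by apply/(measurable_restrictT _ _).1 => //; exact: measurable_funTS.
- by move=> x; rewrite /patch; case: ifPn.
Qed.

Lemma measurable_set_bool d (T : measurableType d) (b : T -> bool) :
  measurable_fun setT b -> measurable [set x | b x].
Proof.
move=> mb; rewrite (_ : mkset _ = b @^-1` [set true])//.
by rewrite -[X in measurable X]setTI; exact: mb.
Qed.

Lemma measurable_set_bool2 d (T : measurableType d) (b c : T -> bool) :
  measurable_fun setT (fun x => b x && c x) -> measurable [set x | b x /\ c x].
Proof.
move=> mb; rewrite (_ : mkset _ = [set x | b x && c x]).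
  exact: measurable_set_bool.
by apply/seteqP; split => x /= /andP.
Qed.

Lemma measurable_sqrtr : measurable_fun setT (@Num.sqrt R).
Proof. by apply: continuous_measurable_fun; exact: sqrt_continuous. Qed.

Lemma in_itv_sqrt (s y : R) : (0 <= s -> y \in `[0, Num.sqrt s] =
  (0 <= y) && (y ^+ 2 <= s))%R.
Proof.
move=> s0; rewrite in_itv/=; have [y0|//] := leP 0%R y.
by rewrite -{1}(ger0_norm y0) -sqrtr_sqr ler_sqrt// sqr_ge0.
Qed.

Lemma sqrt_region (v s y : R) : (0 <= v)%R ->
  `[0%R, v]%classic s /\ `[0%R, Num.sqrt s]%classic y <->
  `[0%R, Num.sqrt v]%classic y /\ `[(y ^+ 2)%R, v]%classic s.
Proof.
move=> v0; rewrite /= (in_itv_sqrt y v0); split.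
  move=> []; rewrite {1}in_itv/= => /andP[s0 sv].
  rewrite (in_itv_sqrt y s0) => /andP[y0 ys].
  by rewrite in_itv/= y0 ys sv (le_trans ys).
rewrite in_itv/= => -[/andP[y0 yv] /andP[ys sv]].
have s0 : (0 <= s)%R by rewrite (le_trans _ ys)// sqr_ge0.
by rewrite (in_itv_sqrt y s0) in_itv/= s0 sv y0 ys.
Qed.

Lemma measurable_below_sqrt (v : R) : measurable
  [set p : R * R | `[0%R, v]%classic p.1 /\ `[0%R, Num.sqrt p.1]%classic p.2].
Proof.
apply: measurable_set_bool2; rewrite [X in measurable_fun _ X](_ : _ =
  fun p : R * R => [&& (0 <= p.1), (p.1 <= v), (0 <= p.2) & (p.2 <= Num.sqrt p.1)]%R); last first.
  by apply/funext => p; rewrite !in_itv/= -andbA.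
do 3?[apply: measurable_and]; apply: measurable_fun_ler => //.
by apply: (measurableT_comp measurable_sqrtr).
Qed.

Lemma measurable_above_sqr (v : R) : measurable
  [set p : R * R | `[0%R, Num.sqrt v]%classic p.1 /\ `[(p.1 ^+ 2)%R, v]%classic p.2].
Proof.
apply: measurable_set_bool2; rewrite [X in measurable_fun _ X](_ : _ =
  fun p : R * R => [&& (0 <= p.1), (p.1 <= Num.sqrt v), (p.1 ^+ 2 <= p.2) & (p.2 <= v)]%R); last first.
  by apply/funext => p; rewrite !in_itv/= -andbA.
do 3?[apply: measurable_and]; apply: measurable_fun_ler => //.
exact: measurable_funX.
Qed.

(** With y the square root of an age at time s, exchanging s and y lets the lag h = v - s run over
    [[0, v - y ^+ 2]]. *)
Lemma triangle_reflect (F : R * R -> \bar R) (v : R) : (0 <= v)%R ->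
  measurable_fun setT F -> (forall p, 0 <= F p) ->
  \int[mu]_(s in `[0%R, v]) \int[mu]_(y in `[0%R, Num.sqrt s]) F (y, v - s)%R =
  \int[mu]_(y in `[0%R, Num.sqrt v]) \int[mu]_(h in `[0%R, (v - y ^+ 2)%R]) F (y, h).
Proof.
move=> v0 mF F0.
rewrite (@tonelli_swap _ _ _ _ _ mu mu `[0%R, v]%classic (fun s => `[0%R, Num.sqrt s]%classic)
  `[0%R, Num.sqrt v]%classic (fun y => `[(y ^+ 2)%R, v]%classic)
  (fun p => F (p.2, (v - p.1)%R)))//=.
- apply: eq_integral => y _.
  rewrite [RHS](lebesgue_affine_set (c := v) (k := -1) (E := `[(y ^+ 2)%R, v]%classic))//.
  + by rewrite normrN1 mul1e; apply: eq_integral => x _; rewrite mulN1r.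
  + move=> x /=; rewrite !in_itv/=; split=> /andP[? ?]; apply/andP; split; lra.
  + apply: (measurableT_comp mF); exact: measurable_pair1.
- by move=> s y; exact: sqrt_region.
- exact: measurable_below_sqrt.
- apply: (measurableT_comp mF); apply/measurable_fun_pair => //=.
  exact: measurable_funB.
Qed.

(** The shift u = h + y^2, followed by an exchange: u is the total span of the age y^2 and the lag
    h. *)
Lemma triangle_shift (F : R * R -> \bar R) (v : R) : (0 <= v)%R ->
  measurable_fun setT F -> (forall p, 0 <= F p) ->
  \int[mu]_(y in `[0%R, Num.sqrt v]) \int[mu]_(h in `[0%R, (v - y ^+ 2)%R]) F (y, h) =
  \int[mu]_(u in `[0%R, v]) \int[mu]_(y in `[0%R, Num.sqrt u]) F (y, u - y ^+ 2)%R.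
Proof.
move=> v0 mF F0.
transitivity (\int[mu]_(y in `[0%R, Num.sqrt v])
    \int[mu]_(u in `[(y ^+ 2)%R, v]) F (y, u - y ^+ 2)%R).
  apply: eq_integral => y _.
  rewrite (lebesgue_affine_set (c := - y ^+ 2) (k := 1) (E := `[(y ^+ 2)%R, v]%classic))//.
  + by rewrite normr1 mul1e; apply: eq_integral => x _; rewrite mul1r addrC.
  + move=> x /=; rewrite !in_itv/=; split=> /andP[? ?]; apply/andP; split; lra.
  + apply: (measurableT_comp mF); exact: measurable_pair1.
rewrite (@tonelli_swap _ _ _ _ _ mu mu `[0%R, Num.sqrt v]%classic (fun y => `[(y ^+ 2)%R, v]%classic)
  `[0%R, v]%classic (fun s => `[0%R, Num.sqrt s]%classic)
  (fun p => F (p.1, (p.2 - p.1 ^+ 2)%R)))//=.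
- move=> s y; split; by move/sqrt_region; apply.
- exact: measurable_above_sqr.
- apply: (measurableT_comp mF); apply/measurable_fun_pair => //=.
  by apply: measurable_funB => //; exact: measurable_funX.
Qed.

End lebesgue_tools.

(** * The Brownian second-moment kernel *)

Section pointwise_continuous.
Context {R : realType} {T : topologicalType}.
Implicit Types f g : T -> R.

Lemma continuous_addr f g : continuous f -> continuous g ->
  continuous (fun y => f y + g y).
Proof. by move=> cf cg x; apply: cvgD; [exact: cf|exact: cg]. Qed.

Lemma continuous_oppr f : continuous f -> continuous (fun y => - f y).
Proof. by move=> cf x; apply: cvgN; exact: cf. Qed.

Lemma continuous_mulr f g : continuous f -> continuous g ->
  continuous (fun y => f y * g y).
Proof. by move=> cf cg x; apply: cvgM; [exact: cf|exact: cg]. Qed.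

Lemma continuous_exprn f n : continuous f -> continuous (fun y => f y ^+ n).
Proof.
move=> cf; elim: n => [|n ih]; first by move=> x; exact: cvg_cst.
rewrite (_ : (fun y => f y ^+ n.+1) = (fun y => f y * f y ^+ n)).
  exact: continuous_mulr.
by apply/funext => x; rewrite exprS.
Qed.

Lemma continuous_chain f (g : R -> R) : continuous g -> continuous f ->
  continuous (fun y => g (f y)).
Proof. by move=> cg cf x; exact: (continuous_comp (cf x) (cg (f x))). Qed.

Lemma continuous_invr f : (forall x, f x != 0) -> continuous f ->
  continuous (fun y => (f y)^-1).
Proof. by move=> f0 cf x; apply: cvgV => //; exact: cf. Qed.

Lemma continuous_const (c : R) : continuous (fun _ : T => c).
Proof. by move=> x; exact: cvg_cst. Qed.

End pointwise_continuous.

Lemma continuous_idfun (T : topologicalType) : continuous (fun x : T => x).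
Proof. by move=> x; exact: cvg_id. Qed.

Section within_continuous.
Context {R : realType} (A : set R).
Implicit Types f g : R -> R.

Lemma within_addr f g : {within A, continuous f} -> {within A, continuous g} ->
  {within A, continuous (fun y => f y + g y)}.
Proof. exact: (@continuous_addr R (subspace A)). Qed.

Lemma within_mulr f g : {within A, continuous f} -> {within A, continuous g} ->
  {within A, continuous (fun y => f y * g y)}.
Proof. exact: (@continuous_mulr R (subspace A)). Qed.

End within_continuous.

(** Structural continuity, one rule per head symbol, leaving only the nonvanishing of denominators.
    The two rules for partially applied operators catch eta-contracted functions. *)
Ltac cont_step :=
  lazymatch goal with
  | |- continuous (fun y => y) => exact: continuous_idfun
  | |- continuous (fun=> ?c) => exact: continuous_const
  | |- continuous ( *%R ?c) => apply: (continuous_mulr (f := fun=> c) (g := fun y => y))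
  | |- continuous (+%R ?c) => apply: (continuous_addr (f := fun=> c) (g := fun y => y))
  | |- continuous (fun y => _ + _) => apply: continuous_addr
  | |- continuous (fun y => - _) => apply: continuous_oppr
  | |- continuous (fun y => _ * _) => apply: continuous_mulr
  | |- continuous (fun y => _ ^+ _) => apply: continuous_exprn
  | |- continuous (fun y => expR _) => apply: (continuous_chain (g := expR)); [exact: continuous_expR|]
  | |- continuous (fun y => Num.sqrt _) => apply: (continuous_chain (g := Num.sqrt)); [exact: sqrt_continuous|]
  | |- continuous (fun y => atan _) => apply: (continuous_chain (g := atan)); [move=> ?; exact: continuous_atan|]
  | |- continuous (fun y => (_)^-1) => apply: continuous_invr
  end.

(** * Explicit primitives and the integrals of the kernel *)

Section calculus.
Context {R : realType}.
Implicit Types (a b x y h u r : R) (f g F : R -> R).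
Local Notation mu := (@lebesgue_measure R).

Lemma is_derive_chain f g x a b : is_derive (f x) 1 g b -> is_derive x 1 f a ->
  is_derive x 1 (fun y => g (f y)) (b * a).
Proof. by move=> dg df; exact: (is_derive1_comp (f := g) (g := f)). Qed.

Lemma measurable_continuous_EFin D f : continuous f ->
  measurable_fun D (fun x => (f x)%:E).
Proof.
move=> cf; apply/measurable_EFinP; apply: measurable_funTS.
exact: continuous_measurable_fun.
Qed.

(** The derivative is asked for in the open interval only: some primitives below contain [asin] and
    sqrt(1 - x^2), which are not differentiable at 1. *)
Lemma FTC2_within f F a b : a < b ->
  {within `[a, b], continuous f} -> {within `[a, b], continuous F} ->
  (forall x, a < x < b -> is_derive x 1 F (f x)) ->
  (\int[mu]_(x in `[a, b]) (f x)%:E)%E = (F b - F a)%:E.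
Proof.
move=> ab cf cF dF; rewrite (continuous_FTC2 (F := F) ab cf)//.
- have [? ? ?] := (continuous_within_itvP F ab).1 cF; split => // x.
  by rewrite in_itv/= => /dF[].
- by move=> x; rewrite in_itv/= => /dF[? <-]; rewrite derive1E.
Qed.

Lemma FTC2_is_derive f F a b : a <= b -> continuous f ->
  (forall x, is_derive x 1 F (f x)) ->
  (\int[mu]_(x in `[a, b]) (f x)%:E)%E = (F b - F a)%:E.
Proof.
rewrite le_eqVlt => /predU1P[<- _ _|ab cf dF].
  by rewrite set_itv1 integral_set1 subrr.
apply: FTC2_within => //; first exact: continuous_subspaceT.
apply: continuous_subspaceT => x; apply: differentiable_continuous.
by apply/derivable1_diffP; have [] := dF x.
Qed.

(** The slope of [asin] is infinite at the endpoints, so continuity is obtained from its being the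
    inverse of [sin] on a segment. *)
Lemma continuous_within_asin : {within `[(-1), 1], continuous (@asin R)}.
Proof.
have := @segment_can_le_continuous R (- (pi / 2)) (pi / 2) sin asin.
rewrite sinN sin_pihalf; apply.
- by rewrite lerNl -subr_ge0 opprK addr_ge0// divr_ge0// pi_ge0.
- by apply: continuous_subspaceT; exact: continuous_sin.
- exact: sinK.
Qed.

Lemma asin0 : asin 0 = 0 :> R.
Proof. by rewrite -[in LHS]sin0 sinK// in_itv/= oppr_le0 andbb divr_ge0// pi_ge0. Qed.

Lemma asin1 : asin 1 = pi / 2 :> R.
Proof.
rewrite -[in LHS]sin_pihalf sinK// in_itv/= lexx andbT lerNl -subr_ge0 opprK.
by rewrite addr_ge0// divr_ge0// pi_ge0.
Qed.

Lemma pi_neq0 : (pi : R) != 0.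
Proof. by rewrite gt_eqF// pi_gt0. Qed.

(* The derivative in y of bm_cov h (y ^ 2), where bm_cov h a = E|B_a B_(a+h)|. *)
Definition bm_kernel h y : R :=
  2 / pi * (Num.sqrt h + 2 * y * atan (y / Num.sqrt h)
            + y ^+ 2 * Num.sqrt h / (h + y ^+ 2)).

Lemma measurable_invr : measurable_fun setT (@GRing.inv R).
Proof.
have -> : [set: R] = [set 0] `|` [set x | x != 0].
  by apply/seteqP; split => // x _ /=; have [->|] := eqVneq x 0; [left|right].
have o0 : open [set x : R | x != 0].
  exact: open_neq.
apply/measurable_funU => //; first exact: open_measurable.
split; first exact: measurable_fun_set1.
apply: open_continuous_measurable_fun => // x; rewrite inE/= => x0.
exact: inv_continuous.
Qed.

Lemma bm_kernel_ge0 h y : 0 <= bm_kernel h y.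
Proof.
have atan_ge0 z : 0 <= z -> 0 <= atan z by move=> z0; rewrite -atan0 le_atan.
have yat : 0 <= y * atan (y / Num.sqrt h).
  have [y0|/ltW y0] := leP 0 y; first by rewrite mulr_ge0 ?atan_ge0 ?divr_ge0.
  rewrite (_ : y * _ = - y * atan (- y / Num.sqrt h)); last first.
    by rewrite !mulNr atanN mulrN opprK.
  by rewrite mulr_ge0 ?oppr_ge0// atan_ge0// divr_ge0// oppr_ge0.
rewrite /bm_kernel mulr_ge0 ?divr_ge0 ?pi_ge0// addr_ge0//.
  by rewrite addr_ge0 ?sqrtr_ge0// -mulrA mulr_ge0.
(* For h <= 0 the square root is 0 by convention and the last term vanishes, whatever the sign of
   its denominator. *)
have [h0|/ltW h0] := leP 0 h; last by rewrite ler0_sqrtr// mulr0 mul0r.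
apply: divr_ge0; last by apply: addr_ge0 => //; exact: sqr_ge0.
by apply: mulr_ge0; [exact: sqr_ge0|exact: sqrtr_ge0].
Qed.

Lemma measurable_bm_kernel :
  measurable_fun setT (fun p : R * R => bm_kernel p.2 p.1).
Proof.
have msq : measurable_fun setT (fun p : R * R => Num.sqrt p.2).
  by apply: (measurableT_comp measurable_sqrtr).
have minv (f : R * R -> R) : measurable_fun setT f ->
    measurable_fun setT (fun p => (f p)^-1).
  by move=> mf; exact: (measurableT_comp measurable_invr).
have mat : measurable_fun setT (@atan R).
  by apply: continuous_measurable_fun => ?; exact: continuous_atan.
apply: measurable_funM => //; apply: measurable_funD.
  apply: measurable_funD => //; apply: measurable_funM; first exact: measurable_funM.
  by apply: (measurableT_comp mat); apply: measurable_funM => //; exact: minv.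
apply: measurable_funM; first by apply: measurable_funM => //; exact: measurable_funX.
by apply: minv; apply: measurable_funD => //; exact: measurable_funX.
Qed.

Definition bm_cov h a : R :=
  2 / pi * (Num.sqrt a * Num.sqrt h + a * atan (Num.sqrt a / Num.sqrt h)).

(** The primitive is [bm_cov h] at y^2. This makes [bm_kernel] the weight in the layer-cake formula
    for [bm_cov] of an age. *)
Lemma integral_bm_kernel h a : 0 < h -> 0 <= a ->
  (\int[mu]_(y in `[0%R, Num.sqrt a]) (bm_kernel h y)%:E)%E = (bm_cov h a)%:E.
Proof.
move=> h0 a0.
have sh0 : 0 < Num.sqrt h by rewrite sqrtr_gt0.
have h'0 y : h + y ^+ 2 != 0 by rewrite gt_eqF// ltr_pwDl// sqr_ge0.
have dF y : is_derive y 1 (fun y => 2 / pi * (y * Num.sqrt h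
    + y ^+ 2 * atan (y / Num.sqrt h))) (bm_kernel h y).
  apply: is_derive_eq; rewrite /GRing.scale/=.
  have eh : h + y ^+ 2 = Num.sqrt h ^+ 2 * (1 + (y / Num.sqrt h) ^+ 2).
    by rewrite -{1}(sqr_sqrtr (ltW h0)); field; rewrite gt_eqF.
  rewrite /bm_kernel eh; have : 1 + (y / Num.sqrt h) ^+ 2 != 0.
    by rewrite gt_eqF// ltr_pwDl// sqr_ge0.
  move: (@pi R) pi_neq0 => p p0 ?; field.
  by rewrite (gt_eqF sh0) sqr_sqrtr ?ltW// h'0.
rewrite (FTC2_is_derive _ _ dF)//.
- rewrite /bm_cov sqr_sqrtr//; congr EFin; ring.
- rewrite /bm_kernel; by repeat cont_step.
Qed.

Lemma is_derive_sqrt1B x : -1 < x < 1 ->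
  is_derive x 1 (fun y => Num.sqrt (1 - y ^+ 2)) (- x / Num.sqrt (1 - x ^+ 2)).
Proof.
move=> x1; have s0 : 0 < 1 - x ^+ 2 by nra.
have ds := is_derive1_sqrt s0.
have d1 : is_derive x 1 (fun y : R => 1 - y ^+ 2) (- (2 * x)).
  by apply: is_derive_eq; rewrite /GRing.scale/=; ring.
apply: is_derive_eq (is_derive_chain (f := fun y => 1 - y ^+ 2) ds d1) _.
by field; rewrite gt_eqF// sqrtr_gt0.
Qed.

Lemma integral_sqrt_scale u (g : R -> R) : 0 < u ->
  measurable_fun setT g -> (forall y, 0 <= g y) ->
  (\int[mu]_(y in `[0%R, Num.sqrt u]) (g y)%:E =
   (Num.sqrt u)%:E * \int[mu]_(x in `[0%R, 1%R]) (g (Num.sqrt u * x))%:E)%E.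
Proof.
move=> u0 mg g0; have su0 : 0 < Num.sqrt u by rewrite sqrtr_gt0.
rewrite (lebesgue_affine_set (c := 0) (k := Num.sqrt u) (E := `[0, 1]%classic))//.
- by rewrite gtr0_norm//; congr (_ * _)%E; apply: eq_integral => x _; rewrite add0r.
- by rewrite gt_eqF.
- by move=> x /=; rewrite !in_itv/= add0r pmulr_rge0// -ler_pdivlMl// mulVf ?gt_eqF.
- exact/measurable_EFinP.
Qed.

Lemma within01_asin : {within `[0, 1], continuous (@asin R)}.
Proof.
apply: continuous_subspaceW continuous_within_asin => x /=.
by rewrite !in_itv/= => /andP[x0 ->]; rewrite (le_trans _ x0)// lerN10.
Qed.

Lemma continuous_sqrt1B : continuous (fun x : R => Num.sqrt (1 - x ^+ 2)).
Proof. by repeat cont_step. Qed.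

(** The area of a quarter disc of radius sqrt u; scaling reduces it to the unit circle. *)
Lemma integral_half_circle u : 0 <= u ->
  (\int[mu]_(y in `[0%R, Num.sqrt u]) (Num.sqrt (u - y ^+ 2))%:E)%E = (pi / 4 * u)%:E.
Proof.
move=> u0; have [->|u_neq0] := eqVneq u 0.
  by rewrite sqrtr0 set_itv1 integral_set1 mulr0.
have {u_neq0}u0 : 0 < u by rewrite lt_neqAle eq_sym u_neq0.
rewrite (@integral_sqrt_scale u (fun y => Num.sqrt (u - y ^+ 2)))//; last first.
  by apply: continuous_measurable_fun; repeat cont_step.
have dF x : 0 < x < 1 -> is_derive x 1
    (fun x => 2^-1 * (x * Num.sqrt (1 - x ^+ 2) + asin x)) (Num.sqrt (1 - x ^+ 2)).
  move=> /andP[x0 x1].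
  have s0 : 0 < 1 - x ^+ 2 by nra.
  have x11 : -1 < x < 1 by apply/andP; split; lra.
  have ds := is_derive_sqrt1B x11; have da := is_derive1_asin x11.
  apply: is_derive_eq; rewrite /GRing.scale/=.
  have := sqr_sqrtr (ltW s0); have : 0 < Num.sqrt (1 - x ^+ 2) by rewrite sqrtr_gt0.
  move: (Num.sqrt _) => s s'0 es; have s_neq0 : s != 0 by rewrite gt_eqF.
  transitivity (2^-1 * (s + (1 - x ^+ 2) / s)); first by field.
  by rewrite -es; field.
under eq_integral => x _.
  rewrite exprMn sqr_sqrtr ?(ltW u0)// -[X in X - _]mulr1 -mulrBr.
  rewrite sqrtrM ?(ltW u0)// EFinM; over.
rewrite ge0_integralZl//=; last first.
  by apply: measurable_continuous_EFin; exact: continuous_sqrt1B.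
rewrite (FTC2_within ltr01 _ _ dF)//.
- rewrite expr1n subrr sqrtr0 asin1 asin0 -!EFinM; congr EFin.
  by rewrite mulrA -expr2 sqr_sqrtr ?(ltW u0)//; field.
- exact/continuous_subspaceT/continuous_sqrt1B.
- apply: within_mulr; first exact/continuous_subspaceT/continuous_const.
  apply: within_addr within01_asin; apply: continuous_subspaceT.
  by repeat cont_step.
Qed.

Lemma atan_asin x : -1 < x < 1 -> atan (x / Num.sqrt (1 - x ^+ 2)) = asin x.
Proof.
move=> /andP[xN1 x1].
have x11 : -1 <= x <= 1 by rewrite !ltW.
rewrite -cos_asin// -[X in X / _](@asinK R x) ?in_itv//=.
rewrite -[_ / _]/(tan (asin x)) tanK// in_itv/= asin_ltpi2 ?x1 ?ltW//.
by rewrite asin_gtNpi2// xN1 ltW.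
Qed.

(** By homogeneity, y = sqrt u x turns the kernel into sqrt u k(x), where [atan] has become [asin].
    The primitive G of k vanishes at 0, and at 1 only its [asin] term survives: (2 / pi) (1/8 + 1)
    (pi / 2) = 9/8. *)
Lemma integral_bm_kernel_diagonal u : 0 <= u ->
  (\int[mu]_(y in `[0%R, Num.sqrt u]) (bm_kernel (u - y ^+ 2) y)%:E)%E =
  (9 / 8 * u)%:E.
Proof.
move=> u0; have [->|u_neq0] := eqVneq u 0.
  by rewrite sqrtr0 set_itv1 integral_set1 mulr0.
have {u_neq0}u0 : 0 < u by rewrite lt_neqAle eq_sym u_neq0.
have su0 : 0 < Num.sqrt u by rewrite sqrtr_gt0.
pose g y := bm_kernel (u - y ^+ 2) y.
have mg : measurable_fun setT g.
  apply: (measurableT_comp measurable_bm_kernel (g := fun y => (y, u - y ^+ 2))).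
  apply/measurable_fun_pair => //.
  by apply: measurable_funB => //; exact: measurable_funX.
have g0 y : 0 <= g y by exact: bm_kernel_ge0.
rewrite (integral_sqrt_scale u0 mg g0).
pose s x := Num.sqrt (1 - x ^+ 2).
pose k x := 2 / pi * (s x + 2 * x * asin x + x ^+ 2 * s x).
pose G x := 2 / pi * (7 / 8 * x * s x + 4^-1 * x ^+ 3 * s x + (8^-1 + x ^+ 2) * asin x).
have sgt0 x : 0 < x < 1 -> 0 < s x by move=> x01; rewrite sqrtr_gt0; nra.
have dG x : 0 < x < 1 -> is_derive x 1 G (k x).
  move=> /[dup] /sgt0 s0 /andP[x0 x1].
  have x11 : -1 < x < 1 by apply/andP; split; lra.
  have ds := is_derive_sqrt1B x11; have da := is_derive1_asin x11.
  apply: is_derive_eq; rewrite /GRing.scale/=.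
  rewrite /k -/(s x); have : s x ^+ 2 = 1 - x ^+ 2.
    rewrite sqr_sqrtr// subr_ge0; nra.
  move: (s x) s0 => z z0 ez; have z_neq0 : z != 0 by rewrite gt_eqF.
  move: pi pi_neq0 => p p0.
  (* The terms in 1 / z are collected so that their numerator contains 1 - x^2 = z^2, which cancels
     the denominator. *)
  transitivity (2 / p * (7 / 8 * z + 3 / 4 * x ^+ 2 * z + 2 * x * asin x
    + (1 - x ^+ 2) * (8^-1 + x ^+ 2 / 4) / z)); first by field; rewrite z_neq0.
  by rewrite -ez; field; rewrite p0.
have cs : {within `[0, 1], continuous s}.
  by apply: continuous_subspaceT; exact: continuous_sqrt1B.
have ck : {within `[0, 1], continuous k}.
  apply: within_mulr; first exact/continuous_subspaceT/continuous_const.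
  apply: (within_addr (within_addr cs (within_mulr _ within01_asin)) (within_mulr _ cs));
    by apply: continuous_subspaceT; repeat cont_step.
have mk : measurable_fun (`]0, 1[%classic : set R) k.
  apply: measurable_funS (subspace_continuous_measurable_fun _ ck) => //.
  exact: subset_itv_oo_cc.
transitivity ((Num.sqrt u)%:E * \int[mu]_(x in `[0%R, 1%R]) (Num.sqrt u * k x)%:E)%E.
  (* The identity fails at x = 1: there h = 0, the quotient under [atan] is 0 by convention, and the
     kernel is 0 while k(1) = 2. Equality on the open interval is enough. *)
  congr (_ * _)%E; apply: eq_integral_itv_bounded.
  - apply: measurable_funTS; apply: (measurableT_comp mg); exact: measurable_funM.
  - exact: measurable_funM.
  - move=> x; rewrite in_itv/= => /[dup] /sgt0 s0 /andP[x0 x1].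
    have x11 : -1 < x < 1 by apply/andP; split; lra.
    rewrite /g /bm_kernel (_ : u - _ = u * (1 - x ^+ 2)); last first.
      by rewrite exprMn sqr_sqrtr ?(ltW u0)//; ring.
    rewrite sqrtrM ?(ltW u0)// -/(s x) -mulf_div divff ?gt_eqF// mul1r atan_asin//.
    rewrite exprMn sqr_sqrtr ?(ltW u0)// /k.
    rewrite (_ : u * (1 - x ^+ 2) + u * x ^+ 2 = u); last by ring.
    by move: pi pi_neq0 => p p0; field; rewrite p0 gt_eqF.
under eq_integral do rewrite EFinM.
rewrite integralZl//=; last first.
  by apply: continuous_compact_integrable ck; exact: segment_compact.
rewrite (FTC2_within ltr01 _ _ dG)//.
- rewrite /G/s expr1n subrr sqrtr0 asin1 asin0 -!EFinM; congr EFin.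
  rewrite mulrA -expr2 sqr_sqrtr ?(ltW u0)//.
  by move: pi pi_neq0 => p p0; field.
- rewrite /G; apply: within_mulr; first exact/continuous_subspaceT/continuous_const.
  apply: (within_addr (within_addr (within_mulr _ cs) (within_mulr _ cs))
    (within_mulr _ within01_asin)); by apply: continuous_subspaceT; repeat cont_step.
Qed.

End calculus.

(** * Integrals over time of the moment densities *)

Section reset_integrals.
Context {R : realType} (r : R) (r0 : 0 < r).
Local Notation mu := (@lebesgue_measure R).
Implicit Types (h u v y T : R).

Lemma continuous_gauss_rate : continuous (fun y => expR (- r * y ^+ 2)).
Proof. by repeat cont_step. Qed.

(** The integrand is the integral of r e^(-r b) over z^2 <= b <= h; after the exchange z ranges over
    an interval of length sqrt b. The resulting single exponential can be merged with e^(-r y^2)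
    later. *)
Lemma integral_survival_defect h : 0 <= h ->
  (\int[mu]_(z in `[0%R, Num.sqrt h]) (expR (- r * z ^+ 2) - expR (- r * h))%:E =
   \int[mu]_(b in `[0%R, h]) (r * Num.sqrt b * expR (- r * b))%:E)%E.
Proof.
move=> h0.
transitivity (\int[mu]_(z in `[0%R, Num.sqrt h])
    \int[mu]_(b in `[(z ^+ 2)%R, h]) (r * expR (- r * b))%:E)%E.
  apply: eq_integral => z; rewrite inE/= in_itv_sqrt// => /andP[z0 zh].
  have dF (b : R) : is_derive b 1 (fun b => - expR (- r * b)) (r * expR (- r * b)).
    by apply: is_derive_eq; rewrite /GRing.scale/=; ring.
  rewrite (FTC2_is_derive _ _ dF)//; last by repeat cont_step.
  by rewrite opprK addrC.
rewrite (@tonelli_swap _ _ _ _ _ mu mu `[0%R, Num.sqrt h]%classic (fun y => `[(y ^+ 2)%R, h]%classic)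
  `[0%R, h]%classic (fun s => `[0%R, Num.sqrt s]%classic)
  (fun p => (r * expR (- r * p.2))%:E))//=.
- apply: eq_integral => b; rewrite inE/= in_itv/= => /andP[b0 bh].
  rewrite integral_cst//= lebesgue_measure_itv/= lte_fin; case: ifPn => [_|].
    by rewrite oppr0 adde0 -EFinM mulrAC.
  rewrite -leNgt => sb0; have -> : Num.sqrt b = 0.
    by apply/eqP; rewrite eq_le sb0 sqrtr_ge0.
  by rewrite mule0 mulr0 mul0r.
- move=> s y; split; by move/sqrt_region; apply.
- exact: measurable_above_sqr.
- by apply/measurable_EFinP; apply: measurable_funM => //; apply: measurableT_comp => //; apply: measurable_funM.
- by move=> p; rewrite lee_fin mulr_ge0 ?expR_ge0// ltW.
Qed.

(* The contributions to E|W_s W_(s+h)|, per unit of the square root y of the age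
   at time s, of no reset and of at least one reset during the time h. *)
Definition same_piece_density h y : \bar R :=
  (expR (- r * h) * bm_kernel h y * expR (- r * y ^+ 2))%:E.

Definition new_piece_density h y : \bar R :=
  (2 / pi * expR (- r * y ^+ 2))%:E *
    \int[mu]_(z in `[0%R, h]) (r * Num.sqrt z * expR (- r * z))%:E.

Lemma same_piece_density_ge0 h y : (0 <= same_piece_density h y)%E.
Proof.
by rewrite lee_fin mulr_ge0 ?expR_ge0// mulr_ge0 ?expR_ge0// bm_kernel_ge0.
Qed.

Lemma new_piece_density_ge0 h y : (0 <= new_piece_density h y)%E.
Proof.
apply: mule_ge0; first by rewrite lee_fin !mulr_ge0 ?expR_ge0 ?invr_ge0 ?pi_ge0.
by apply: integral_ge0 => z _; rewrite lee_fin !mulr_ge0 ?expR_ge0// ltW.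
Qed.

Let measurable_exp_rate d (T : measurableType d) (f : T -> R) :
  measurable_fun setT f -> measurable_fun setT (fun p => expR (- r * f p)).
Proof. by move=> mf; apply: measurableT_comp => //; exact: measurable_funM. Qed.

Lemma measurable_same_piece_density :
  measurable_fun setT (fun p : R * R => same_piece_density p.2 p.1).
Proof.
apply/measurable_EFinP; apply: measurable_funM; first apply: measurable_funM.
- exact: measurable_exp_rate.
- exact: measurable_bm_kernel.
- by apply: measurable_exp_rate; exact: measurable_funX.
Qed.

Lemma measurable_new_piece_density :
  measurable_fun setT (fun p : R * R => new_piece_density p.2 p.1).
Proof.
apply: emeasurable_funM.
  apply/measurable_EFinP; apply: measurable_funM => //.
  by apply: measurable_exp_rate; exact: measurable_funX.
apply: (@measurableT_comp _ _ _ _ _ _ (fun h => \int[mu]_(z in `[0%R, h])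
  (r * Num.sqrt z * expR (- r * z))%:E)%E _ snd) => //.
apply: (@measurable_integral_section _ _ _ _ _ mu (fun h => `[0%R, h]%classic)
  (fun p => (r * Num.sqrt p.2 * expR (- r * p.2))%:E)).
- apply: measurable_set_bool; rewrite [X in measurable_fun _ X](_ : _ =
    fun p : R * R => (0 <= p.2) && (p.2 <= p.1)).
    by apply: measurable_and; exact: measurable_fun_ler.
  by apply/funext => p; rewrite in_itv.
- apply/measurable_EFinP; apply: measurable_funM; last exact: measurable_exp_rate.
  by apply: measurable_funM => //; exact: (measurableT_comp measurable_sqrtr).
- by move=> p; rewrite lee_fin !mulr_ge0 ?expR_ge0// ltW.
Qed.

Lemma integral_xexp u : 0 <= u ->
  (\int[mu]_(x in `[0%R, u]) (x * expR (- r * x))%:E)%E =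
  ((1 - (1 + r * u) * expR (- r * u)) / r ^+ 2)%:E.
Proof.
move=> u0; have rn0 : r != 0 by rewrite gt_eqF.
have dF (x : R) : is_derive x 1 (fun x => - (1 + r * x) / r ^+ 2 * expR (- r * x))
    (x * expR (- r * x)).
  by apply: is_derive_eq; rewrite /GRing.scale/=; field.
rewrite (FTC2_is_derive _ _ dF)//; last by repeat cont_step.
by rewrite !mulr0 expR0; congr EFin; field.
Qed.

(** On the diagonal h = u - y^2 the two exponentials multiply to e^(-r u), which does not depend on
    y. *)
Lemma integral_same_piece_diagonal u : 0 <= u ->
  (\int[mu]_(y in `[0%R, Num.sqrt u]) same_piece_density (u - y ^+ 2) y =
   (9 / 8 * (u * expR (- r * u)))%:E)%E.
Proof.
move=> u0.
have mk : measurable_fun setT (fun y : R => bm_kernel (u - y ^+ 2) y).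
  apply: (measurableT_comp measurable_bm_kernel (g := fun y => (y, u - y ^+ 2))).
  apply/measurable_fun_pair => //.
  by apply: measurable_funB => //; exact: measurable_funX.
transitivity (\int[mu]_(y in `[0%R, Num.sqrt u])
    ((expR (- r * u))%:E * (bm_kernel (u - y ^+ 2) y)%:E))%E.
  apply: eq_integral => y _; rewrite -EFinM; congr EFin.
  by rewrite mulrAC -expRD; congr (expR _ * _); ring.
rewrite ge0_integralZl//=.
- by rewrite integral_bm_kernel_diagonal// -EFinM; congr EFin; ring.
- by apply/measurable_EFinP/measurable_funTS.
- by move=> y _; rewrite lee_fin bm_kernel_ge0.
Qed.

(** The variable z of the density is shifted to x = y^2 + z: the exponentials give e^(-r x), and the
    factor sqrt(x - y^2) integrates to a quarter disc. Hence r / 2 = (2 / pi) r (pi / 4). *)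
Lemma integral_new_piece_diagonal u : 0 <= u ->
  (\int[mu]_(y in `[0%R, Num.sqrt u]) new_piece_density (u - y ^+ 2) y =
   (r / 2 * ((1 - (1 + r * u) * expR (- r * u)) / r ^+ 2))%:E)%E.
Proof.
move=> u0.
pose F (p : R * R) : \bar R :=
  ((2 / pi * expR (- r * p.1 ^+ 2)) * (r * Num.sqrt p.2 * expR (- r * p.2)))%:E.
transitivity (\int[mu]_(y in `[0%R, Num.sqrt u])
    \int[mu]_(z in `[0%R, (u - y ^+ 2)%R]) F (y, z))%E.
  apply: eq_integral => y _; rewrite /new_piece_density /F -ge0_integralZl//=.
  - apply/measurable_EFinP/measurable_funTS; apply: measurable_funM.
      by apply: measurable_funM => //; exact: measurable_sqrtr.
    exact: measurable_exp_rate.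
  - by move=> z _; rewrite lee_fin !mulr_ge0 ?expR_ge0// ltW.
  - by rewrite lee_fin !mulr_ge0 ?expR_ge0 ?invr_ge0 ?pi_ge0.
rewrite triangle_shift//.
- transitivity (\int[mu]_(x in `[0%R, u]) ((r / 2)%:E * (x * expR (- r * x))%:E))%E.
    apply: eq_integral => x; rewrite inE/= in_itv/= => /andP[x0 xu].
    transitivity (\int[mu]_(y in `[0%R, Num.sqrt x])
      ((2 / pi * r * expR (- r * x))%:E * (Num.sqrt (x - y ^+ 2))%:E))%E.
      apply: eq_integral => y _; rewrite /F/= -EFinM; congr EFin.
      rewrite (_ : - r * x = - r * y ^+ 2 + - r * (x - y ^+ 2)); last by ring.
      by rewrite expRD; ring.
    rewrite ge0_integralZl//=.
    + rewrite integral_half_circle// -!EFinM; congr EFin.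
      by move: (@pi R) (@pi_neq0 R) => p p0; field.
    + by apply: measurable_continuous_EFin; repeat cont_step.
    + by rewrite lee_fin !mulr_ge0 ?expR_ge0 ?invr_ge0 ?pi_ge0// ltW.
  rewrite ge0_integralZl//=.
  + by rewrite integral_xexp// -EFinM.
  + by apply: measurable_continuous_EFin; repeat cont_step.
  + by move=> x; rewrite in_itv/= => /andP[x0 _]; rewrite lee_fin mulr_ge0 ?expR_ge0.
  + by rewrite lee_fin divr_ge0// ltW.
- apply/measurable_EFinP; apply: measurable_funM.
    by apply: measurable_funM => //; apply: measurable_exp_rate; exact: measurable_funX.
  apply: measurable_funM; last exact: measurable_exp_rate.
  by apply: measurable_funM => //; exact: (measurableT_comp measurable_sqrtr).
- by move=> p; rewrite lee_fin !mulr_ge0 ?expR_ge0 ?invr_ge0 ?pi_ge0// ltW.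
Qed.

Definition second_moment_density h y : \bar R :=
  same_piece_density h y + new_piece_density h y.

Lemma second_moment_density_ge0 h y : (0 <= second_moment_density h y)%E.
Proof.
by apply: adde_ge0; [exact: same_piece_density_ge0|exact: new_piece_density_ge0].
Qed.

Lemma measurable_second_moment_density :
  measurable_fun setT (fun p : R * R => second_moment_density p.2 p.1).
Proof.
apply: emeasurable_funD; first exact: measurable_same_piece_density.
exact: measurable_new_piece_density.
Qed.

(** For a fixed later time v, the earlier time s is traded for u = y^2 + (v - s), so that only the
    two diagonal integrals, over 0 <= u <= v, remain. *)
Lemma integral_second_moment_density v : 0 <= v ->
  (\int[mu]_(s in `[0%R, v]) \int[mu]_(y in `[0%R, Num.sqrt s])
     second_moment_density (v - s) y =
   ((8^-1 + r * v / 2 - (8^-1 + 5 / 8 * r * v) * expR (- r * v)) / r ^+ 2)%:E)%E.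
Proof.
move=> v0; have rn0 : r != 0 by rewrite gt_eqF.
pose F p := second_moment_density p.2 p.1.
have mF : measurable_fun setT F by exact: measurable_second_moment_density.
have F0 p : (0 <= F p)%E by exact: second_moment_density_ge0.
rewrite (triangle_reflect (F := F))// triangle_shift//.
have mdiag (G : R * R -> \bar R) u D : measurable_fun setT G ->
    measurable_fun D (fun y => G (y, u - y ^+ 2)).
  move=> mG; apply: measurable_funTS; apply: (measurableT_comp mG).
  apply/measurable_fun_pair => //.
  by apply: measurable_funB => //; exact: measurable_funX.
pose g u := 9 / 8 * (u * expR (- r * u))
  + r / 2 * ((1 - (1 + r * u) * expR (- r * u)) / r ^+ 2).
transitivity (\int[mu]_(u in `[0%R, v]) (g u)%:E)%E.
  apply: eq_integral => u; rewrite inE/= in_itv/= => /andP[u0 uv].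
  rewrite ge0_integralD//=.
  - by rewrite integral_same_piece_diagonal// integral_new_piece_diagonal.
  - by move=> y _; exact: same_piece_density_ge0.
  - by apply: (mdiag (fun p => same_piece_density p.2 p.1));
      exact: measurable_same_piece_density.
  - by move=> y _; exact: new_piece_density_ge0.
  - by apply: (mdiag (fun p => new_piece_density p.2 p.1));
      exact: measurable_new_piece_density.
have dG (x : R) : is_derive x 1 (fun x => (r * x / 2 - (8^-1 + 5 / 8 * r * x) * expR (- r * x)) / r ^+ 2)
    (g x).
  by apply: is_derive_eq; rewrite /g /GRing.scale/=; field.
rewrite (FTC2_is_derive _ _ dG)//; last by rewrite /g; repeat cont_step.
by rewrite !mulr0 expR0; congr EFin; field.
Qed.

Lemma integral_second_moment_triangle T : 0 <= T ->
  (\int[mu]_(t in `[0%R, T]) \int[mu]_(s in `[0%R, t])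
    \int[mu]_(y in `[0%R, Num.sqrt s]) second_moment_density (t - s) y =
   ((2 * (r * T) ^+ 2 + r * T - 6 + (5 * (r * T) + 6) * expR (- (r * T)))
     / (8 * r ^+ 3))%:E)%E.
Proof.
move=> T0; have rn0 : r != 0 by rewrite gt_eqF.
pose g v := (8^-1 + r * v / 2 - (8^-1 + 5 / 8 * r * v) * expR (- r * v)) / r ^+ 2.
transitivity (\int[mu]_(v in `[0%R, T]) (g v)%:E)%E.
  apply: eq_integral => u; rewrite inE/= in_itv/= => /andP[u0 uv].
  exact: integral_second_moment_density.
(* At 0 this primitive equals 6 / (8 r^3), the origin of the -6 in [f2]. *)
have dG (x : R) : is_derive x 1 (fun x => (2 * (r * x) ^+ 2 + r * x + (5 * (r * x) + 6) * expR (- r * x))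
     / (8 * r ^+ 3)) (g x).
  by apply: is_derive_eq; rewrite /g /GRing.scale/=; field.
rewrite (FTC2_is_derive _ _ dG)//; last by rewrite /g; repeat cont_step.
by rewrite !mulr0 expR0 mulNr; congr EFin; field.
Qed.

Lemma integral_gauss_erf T : 0 < T ->
  (\int[mu]_(y in `[0%R, Num.sqrt T]) (expR (- r * y ^+ 2))%:E =
   (Num.sqrt pi / (2 * Num.sqrt r) * erf (Num.sqrt (r * T)))%:E)%E.
Proof.
move=> T0; have sr0 : 0 < Num.sqrt r by rewrite sqrtr_gt0.
have sT0 : 0 < Num.sqrt T by rewrite sqrtr_gt0.
have mg : measurable_fun setT (fun u : R => (expR (- u ^+ 2))%:E).
  by apply: measurable_continuous_EFin; repeat cont_step.
(* [erf] is defined by a real-valued integral, so the extended one must be finite to be recovered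
   from it. *)
have fing : (\int[mu]_(y in `[0%R, Num.sqrt (r * T)]) (expR (- y ^+ 2))%:E)%E \is a fin_num.
  apply: integrable_fin_num => //; apply: continuous_compact_integrable.
    exact: segment_compact.
  by apply: continuous_subspaceT; repeat cont_step.
rewrite /erf /Rintegral EFinM [X in (_ * X)%E]EFinM fineK//.
rewrite [in RHS](@lebesgue_affine_set _ 0 (Num.sqrt r) _ _ `[0, Num.sqrt T]%classic)//.
- rewrite gtr0_norm// !muleA -!EFinM.
  rewrite (_ : Num.sqrt pi / _ * _ * _ = 1) ?mul1e; last first.
    have := sqrtr_gt0 (@pi R); rewrite pi_gt0; move: (Num.sqrt pi) => p p0.
    by field; rewrite !gt_eqF.
  by apply: eq_integral => y _; rewrite add0r exprMn sqr_sqrtr ?ltW// mulNr.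
- by rewrite gt_eqF.
- move=> x /=; rewrite !in_itv/= add0r sqrtrM ?(ltW r0)//.
  by rewrite pmulr_rge0// ler_pM2l.
Qed.

Lemma powR_three_halves (x : R) : 0 <= x -> x `^ (3 / 2) = x * Num.sqrt x.
Proof.
rewrite le_eqVlt => /predU1P[<-|x0].
  by rewrite powR0 ?mul0r// mulf_neq0.
rewrite (_ : 3 / 2 = 1 + 2^-1); last by field.
by rewrite powRD ?powRr1 ?powR12_sqrt ?ltW// gt_eqF// implybT.
Qed.

Lemma integral_mean T : 0 < T ->
  (\int[mu]_(t in `[0%R, T]) ((Num.sqrt (2 / pi))%:E *
     \int[mu]_(y in `[0%R, Num.sqrt t]) (expR (- r * y ^+ 2))%:E) =
   (T `^ (3 / 2) * f1 (r * T))%:E)%E.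
Proof.
move=> T0; have sT0 : 0 < Num.sqrt T by rewrite sqrtr_gt0.
have sr0 : 0 < Num.sqrt r by rewrite sqrtr_gt0.
pose c : R := Num.sqrt (2 / pi).
have c0 : 0 <= c by exact: sqrtr_ge0.
transitivity (\int[mu]_(t in `[0%R, T]) \int[mu]_(y in `[0%R, Num.sqrt t])
    (c * expR (- r * y ^+ 2))%:E)%E.
  apply: eq_integral => t _; rewrite -ge0_integralZl//=.
  by apply: measurable_continuous_EFin; exact: continuous_gauss_rate.
rewrite (@tonelli_swap _ _ _ _ _ mu mu `[0%R, T]%classic (fun s => `[0%R, Num.sqrt s]%classic)
  `[0%R, Num.sqrt T]%classic (fun y => `[(y ^+ 2)%R, T]%classic)
  (fun p => (c * expR (- r * p.2 ^+ 2))%:E)); last 4 first.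
- by move=> s y; apply: sqrt_region; exact: ltW.
- exact: measurable_below_sqrt.
- apply/measurable_EFinP; apply: measurable_funM => //.
  by apply: measurable_exp_rate; exact: measurable_funX.
- by move=> p; rewrite lee_fin mulr_ge0 ?expR_ge0.
(* The exchange leaves the weight T - y^2. Integration by parts, through F, replaces y^2 e^(-r y^2)
   by a multiple of the Gaussian and a boundary term: hence the factor 2 rho - 1 before [erf] and
   the isolated exponential in [f1]. *)
pose F y := y * expR (- r * y ^+ 2).
pose F' y := (1 - 2 * r * y ^+ 2) * expR (- r * y ^+ 2).
have dF (y : R) : is_derive y 1 F (F' y).
  by apply: is_derive_eq; rewrite /F' /GRing.scale/=; ring.
have cF' : continuous F' by rewrite /F'; repeat cont_step.
have IF := FTC2_is_derive (ltW sT0) cF' dF.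
have iF' : mu.-integrable `[0, Num.sqrt T] (EFin \o F').
  apply: continuous_compact_integrable; first exact: segment_compact.
  exact: continuous_subspaceT.
have ig : mu.-integrable `[0, Num.sqrt T] (EFin \o (fun y => expR (- r * y ^+ 2))).
  apply: continuous_compact_integrable; first exact: segment_compact.
  by apply: continuous_subspaceT; exact: continuous_gauss_rate.
transitivity (\int[mu]_(y in `[0%R, Num.sqrt T])
    ((c * (T - (2 * r)^-1))%:E * (expR (- r * y ^+ 2))%:E + (c / (2 * r))%:E * (F' y)%:E))%E.
  apply: eq_integral => y.
  rewrite inE/= in_itv_sqrt ?(ltW T0)// => /andP[y0 yT].
  rewrite integral_cst//= lebesgue_measure_itv/= lte_fin -!EFinM -!EFinD.
  case: ifPn => [_|].
    by rewrite -EFinM; congr EFin; rewrite /F'; field; rewrite gt_eqF.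
  rewrite -leNgt => Ty; have y2 : y ^+ 2 = T by apply/eqP; rewrite eq_le yT Ty.
  by rewrite mule0; congr EFin; rewrite /F' y2; field; rewrite gt_eqF.
rewrite integralD//=; last 2 first.
- exact: integrableZl.
- exact: integrableZl.
rewrite !integralZl// IF integral_gauss_erf// -!EFinM -EFinD; congr EFin.
rewrite /F/f1 mul0r subr0 sqr_sqrtr ?(ltW T0)//.
rewrite !powR_three_halves ?mulr_ge0 ?(ltW T0) ?(ltW r0)//.
rewrite /c sqrtrM// sqrtrV ?pi_ge0// (sqrtrM pi)// (sqrtrM T) ?(ltW r0)//.
have p0 : 0 < Num.sqrt (@pi R) by rewrite sqrtr_gt0 pi_gt0.
have A0 : 0 < Num.sqrt (2 : R) by rewrite sqrtr_gt0.
have A2 : Num.sqrt (2 : R) ^+ 2 = 2 by rewrite sqr_sqrtr.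
have := sqr_sqrtr (ltW T0); have := sqr_sqrtr (ltW r0).
rewrite mulNr; move: (erf _) (expR _) => I E'.
move: (Num.sqrt pi) p0 (Num.sqrt 2) A0 A2 (Num.sqrt T) sT0 (Num.sqrt r) sr0.
move=> p p0 A A0 A2 q q0 s s0 sr qT; rewrite -qT -sr.
rewrite (_ : 1 / (A * p) = A / (2 * p)); last first.
  by rewrite -A2; field; rewrite !gt_eqF.
by field; rewrite !gt_eqF.
Qed.

End reset_integrals.

(** * Gaussian moments *)

Section gaussian_integrals.
Context {R : realType}.
Local Notation mu := (@lebesgue_measure R).
Implicit Types (a c h x y z : R).

Lemma cvg_xexpN : (t * expR (- t)) @[t --> +oo] --> (0 : R).
Proof.
apply: (@squeeze_cvgr _ _ _ _ (cst 0) (fun t : R => 2 * t^-1)).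
- near=> t; have t0 : 0 < t by near: t; exact: nbhs_pinfty_gt.
  rewrite /= mulr_ge0 ?expR_ge0 ?(ltW t0)//= expRN ler_pdivrMr ?expR_gt0//.
  have := expR_ge1Dxn 1 (ltW t0); rewrite (_ : 2`!%:R = 2)// => et.
  rewrite [leLHS](_ : t = 2 / t * (t ^+ 2 / 2)); last by field; rewrite gt_eqF.
  by rewrite ler_pM2l ?divr_gt0// (le_trans _ et)// lerDr.
- exact: cvg_cst.
- rewrite -[X in _ --> X](mulr0 2); apply: cvgM; first exact: cvg_cst.
  by apply/(gtr0_cvgV0 (f := id)) => //; exact: nbhs_pinfty_gt.
Unshelve. all: by end_near. Qed.

Lemma cvg_half_sqr c : 0 < c -> (c * x ^+ 2 / 2) @[x --> +oo] --> +oo.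
Proof.
move=> c0; have := gt0_cvgMly (divr_gt0 c0 (ltr0Sn R 1)) (@cvgr_expr2 R).
rewrite (_ : (fun x => c * x ^+ 2 / 2) = (fun x => x ^+ 2 * (c / 2))); first exact.
by apply/funext => x; ring.
Qed.

Lemma half_gauss_first_moment c : 0 < c ->
  (\int[mu]_(x in `[0%R, +oo[) (x * expR (- (c * x ^+ 2 / 2)))%:E)%E = (c^-1)%:E.
Proof.
move=> c0; have cn0 : c != 0 by rewrite gt_eqF.
have dF (x : R) : is_derive x 1 (fun x => - c^-1 * expR (- (c * x ^+ 2 / 2)))
    (x * expR (- (c * x ^+ 2 / 2))).
  by apply: is_derive_eq; rewrite /GRing.scale/=; field.
have cF : continuous (fun x => - c^-1 * expR (- (c * x ^+ 2 / 2))).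
  by repeat cont_step.
rewrite (ge0_continuous_FTC2y (l := 0) (F := fun x => - c^-1 * expR (- (c * x ^+ 2 / 2))))//.
- by rewrite expr0n mulr0 mul0r oppr0 expR0 mulr1 -EFinB sub0r opprK.
- by move=> x x0; rewrite mulr_ge0 ?expR_ge0.
- by apply: continuous_subspaceT; repeat cont_step.
- rewrite -[X in _ --> X](mulr0 (- c^-1)); apply: cvgM; first exact: cvg_cst.
  exact: (cvg_comp _ _ (cvg_half_sqr c0) (@cvgr_expR R)).
- by apply: cvg_at_right_filter; exact: cF.
- by move=> x _; have [? <-] := dF x; rewrite derive1E.
Qed.

Lemma half_gauss_third_moment c : 0 < c ->
  (\int[mu]_(x in `[0%R, +oo[) (x ^+ 3 * expR (- (c * x ^+ 2 / 2)))%:E)%E =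
  (2 / c ^+ 2)%:E.
Proof.
move=> c0; have cn0 : c != 0 by rewrite gt_eqF.
pose F x := - (2 / c ^+ 2) * ((c * x ^+ 2 / 2) * expR (- (c * x ^+ 2 / 2))
  + expR (- (c * x ^+ 2 / 2))).
have dF (x : R) : is_derive x 1 F (x ^+ 3 * expR (- (c * x ^+ 2 / 2))).
  by apply: is_derive_eq; rewrite /GRing.scale/=; field.
have cF : continuous F by rewrite /F; repeat cont_step.
rewrite (ge0_continuous_FTC2y (l := 0) (F := F))//.
- by rewrite -EFinB /F expr0n/= mulr0 mul0r oppr0 expR0; congr EFin; ring.
- by move=> x x0; rewrite mulr_ge0 ?expR_ge0// exprn_ge0.
- by apply: continuous_subspaceT; repeat cont_step.
- rewrite -[X in _ --> X](mulr0 (- (2 / c ^+ 2))); apply: cvgM; first exact: cvg_cst.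
  rewrite -[X in _ --> X]addr0; apply: cvgD.
    exact: (cvg_comp _ _ (cvg_half_sqr c0) cvg_xexpN).
  exact: (cvg_comp _ _ (cvg_half_sqr c0) (@cvgr_expR R)).
- by apply: cvg_at_right_filter; exact: cF.
- by move=> x _; have [? <-] := dF x; rewrite derive1E.
Qed.

Lemma ge0_integral_reflect (f : R -> \bar R) :
  measurable_fun setT f -> (forall x, (0 <= f x)%E) ->
  (\int[mu]_x f x = \int[mu]_(x in `[0%R, +oo[) (f x + f (- x)%R))%E.
Proof.
move=> mf f0.
have mfN : measurable_fun setT (fun x => f (- x)) by exact: measurableT_comp.
rewrite ge0_integralD//=; try exact: measurable_funTS.
have -> : [set: R] = `[0%R, +oo[%classic `|` `]-oo, 0%R[%classic.
  by apply/seteqP; split => // x _ /=; rewrite !in_itv/= andbT; case: leP; [left|right].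
rewrite ge0_integral_setU//=; last 2 first.
- exact: measurable_funTS.
- by apply/disj_setPLR => x /=; rewrite !in_itv/= andbT => x0; apply/negP; rewrite -leNgt.
congr (_ + _)%E; rewrite (lebesgue_affine_set (c := 0) (k := -1) (E := `]0%R, +oo[%classic))//.
- rewrite normrN1 mul1e.
  rewrite -integral_itv_obnd_cbnd; last exact: measurable_funTS.
  by apply: eq_integral => x _; rewrite mulN1r add0r.
- by move=> x /=; rewrite !in_itv/= mulN1r add0r oppr_lt0 andbT.
Qed.

(** The normal density of variance a. The exponent has the form c x^2 / 2, with c = a^-1, of the
    half-line moments. *)
Definition centered_pdf a x : R :=
  (Num.sqrt (2 * pi * a))^-1 * expR (- (a^-1 * x ^+ 2 / 2)).

Lemma centered_pdf_ge0 a x : 0 <= centered_pdf a x.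
Proof. by rewrite mulr_ge0 ?expR_ge0// invr_ge0. Qed.

Lemma centered_pdfN a x : centered_pdf a (- x) = centered_pdf a x.
Proof. by rewrite /centered_pdf sqrrN. Qed.

Lemma continuous_centered_pdf a : continuous (centered_pdf a).
Proof. by rewrite /centered_pdf; repeat cont_step. Qed.

Lemma normal_pdf_centered a : 0 < a -> normal_pdf 0 (Num.sqrt a) = centered_pdf a.
Proof.
move=> a0; apply/funext => x; rewrite /normal_pdf gt_eqF ?sqrtr_gt0//.
rewrite /normal_peak /normal_fun /centered_pdf subr0 sqr_sqrtr ?ltW//.
rewrite -[_ * pi *+ 2]mulr_natr -[a *+ 2]mulr_natr.
rewrite (_ : a * pi * 2 = 2 * pi * a); last by ring.
by congr (_ * expR _); field; rewrite gt_eqF.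
Qed.

Lemma integral_norm_centered_pdf a : 0 < a ->
  (\int[mu]_x (`|x| * centered_pdf a x)%:E)%E = (Num.sqrt (2 / pi) * Num.sqrt a)%:E.
Proof.
move=> a0.
have mf : measurable_fun setT (fun x : R => (`|x| * centered_pdf a x)%:E).
  apply/measurable_EFinP; apply: measurable_funM; first exact: normr_measurable.
  by apply: continuous_measurable_fun; exact: continuous_centered_pdf.
rewrite ge0_integral_reflect//; last first.
  by move=> x; rewrite lee_fin mulr_ge0 ?centered_pdf_ge0.
transitivity (\int[mu]_(x in `[0%R, +oo[) ((2 / Num.sqrt (2 * pi * a))%:E *
    (x * expR (- (a^-1 * x ^+ 2 / 2)))%:E))%E.
  apply: eq_integral => x; rewrite inE/= in_itv/= andbT => x0.
  rewrite normrN centered_pdfN ger0_norm// -EFinD -EFinM; congr EFin.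
  by rewrite /centered_pdf; ring.
rewrite ge0_integralZl//=.
- rewrite half_gauss_first_moment ?invr_gt0// -EFinM; congr EFin; rewrite invrK.
  have p0 : 0 < Num.sqrt (@pi R) by rewrite sqrtr_gt0 pi_gt0.
  have A0 : 0 < Num.sqrt (2 : R) by rewrite sqrtr_gt0.
  have A2 : Num.sqrt (2 : R) ^+ 2 = 2 by rewrite sqr_sqrtr.
  have sa0 : 0 < Num.sqrt a by rewrite sqrtr_gt0.
  rewrite !sqrtrM ?mulr_ge0 ?pi_ge0// sqrtrV ?pi_ge0//.
  have := sqr_sqrtr (ltW a0).
  move: (Num.sqrt pi) p0 (Num.sqrt 2) A0 A2 (Num.sqrt a) sa0 => p p0 A A0 A2 s s0 <-.
  by rewrite -[X in X / _]A2; field; rewrite !gt_eqF.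
- by apply: measurable_continuous_EFin; repeat cont_step.
- by move=> x; rewrite in_itv/= andbT => x0; rewrite lee_fin mulr_ge0 ?expR_ge0.
Qed.

(** Two foldings: changing the sign of both variables reduces to x >= 0 with a factor 2, and
    changing that of y alone gives |x + y| + |x - y| = 2 max(x, y). *)
Lemma gauss_cov_quadrant a h : 0 < a -> 0 < h ->
  (\int[mu]_x \int[mu]_y (`|x| * `|x + y| * centered_pdf a x * centered_pdf h y)%:E =
   \int[mu]_(x in `[0%R, +oo[) \int[mu]_(y in `[0%R, +oo[)
     (4 * x * Num.max x y * centered_pdf a x * centered_pdf h y)%:E)%E.
Proof.
move=> a0 h0.
pose g (p : R * R) := `|p.1| * `|p.1 + p.2| * centered_pdf a p.1 * centered_pdf h p.2.
have mpdf b : measurable_fun setT (centered_pdf b).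
  by apply: continuous_measurable_fun; exact: continuous_centered_pdf.
have mg : measurable_fun setT (fun p => (g p)%:E).
  apply/measurable_EFinP; apply: measurable_funM; last exact: measurableT_comp.
  apply: measurable_funM; last exact: measurableT_comp.
  by apply: measurable_funM; apply: measurableT_comp => //; exact: measurable_funD.
have g0 p : (0 <= (g p)%:E)%E by rewrite lee_fin !mulr_ge0 ?centered_pdf_ge0.
pose I x := (\int[mu]_y (g (x, y))%:E)%E.
have mI : measurable_fun setT I.
  exact: (measurable_fun_fubini_tonelli_F (m2 := mu) _ mg g0).
have I0 x : (0 <= I x)%E by exact: integral_ge0.
have mgx x : measurable_fun setT (fun y => (g (x, y))%:E).
  by apply: (measurableT_comp mg); exact: measurable_pair1.
have IN x : I (- x) = I x.
  rewrite /I [LHS](lebesgue_affine 0 (k := -1))// normrN1 mul1e.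
  apply: eq_integral => y _; rewrite /g/= add0r mulN1r centered_pdfN -opprD !normrN.
  by rewrite centered_pdfN.
rewrite [LHS]ge0_integral_reflect//.
apply: eq_integral => x; rewrite inE/= in_itv/= andbT => x0.
rewrite -!/(I _) IN /I ge0_integral_reflect// -mule2n.
rewrite -[LHS]mule_natl -ge0_integralZl//=.
- apply: eq_integral => y; rewrite inE/= in_itv/= andbT => y0.
  rewrite -EFinD -EFinM; congr EFin; rewrite /g/= centered_pdfN (ger0_norm x0) ger0_norm ?addr_ge0//.
  have [xy|/ltW xy] := leP x y.
    by rewrite ler0_norm ?subr_le0//; ring.
  by rewrite ger0_norm ?subr_ge0//; ring.
- apply: measurable_funTS; apply: emeasurable_funD; first exact: mgx.
  exact: (measurableT_comp (mgx x)).
- by move=> y _; rewrite adde_ge0.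
Qed.

(** Along the ray y = x z the exponents add up to c x^2 / 2 with c = 1/a + z^2/h, and the leading
    factor x is the Jacobian. This is a third half-line moment, 2 / c^2. *)
Lemma gauss_cov_radial a h z : 0 < a -> 0 < h ->
  (\int[mu]_(x in `[0%R, +oo[)
     (x * (4 * x * Num.max x (x * z) * centered_pdf a x * centered_pdf h (x * z)))%:E =
   (4 / pi * (a * h * Num.sqrt a * Num.sqrt h) *
     (Num.max 1 z / (h + a * z ^+ 2) ^+ 2))%:E)%E.
Proof.
move=> a0 h0; pose c := a^-1 + z ^+ 2 / h.
have c0 : 0 < c by rewrite ltr_pwDl ?invr_gt0// divr_ge0 ?sqr_ge0// ltW.
transitivity (\int[mu]_(x in `[0%R, +oo[)
   ((4 * Num.max 1 z / (Num.sqrt (2 * pi * a) * Num.sqrt (2 * pi * h)))%:E *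
    (x ^+ 3 * expR (- (c * x ^+ 2 / 2)))%:E))%E.
  apply: eq_integral => x; rewrite inE/= in_itv/= andbT => x0.
  rewrite -EFinM; congr EFin.
  rewrite (_ : Num.max x (x * z) = x * Num.max 1 z); last first.
    by rewrite maxr_pMr// mulr1.
  rewrite /centered_pdf (_ : c * x ^+ 2 / 2 = a^-1 * x ^+ 2 / 2 + h^-1 * (x * z) ^+ 2 / 2).
    by rewrite opprD expRD invfM; ring.
  by rewrite /c; field; rewrite !gt_eqF.
rewrite ge0_integralZl//=.
- rewrite half_gauss_third_moment// -EFinM; congr EFin.
  rewrite !sqrtrM ?mulr_ge0 ?pi_ge0//.
  have -> : c = (h + a * z ^+ 2) / (a * h) by rewrite /c; field; rewrite !gt_eqF.
  have k0 : 0 < h + a * z ^+ 2 by rewrite ltr_pwDl// mulr_ge0 ?sqr_ge0// ltW.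
  have sa0 : 0 < Num.sqrt a by rewrite sqrtr_gt0.
  have sh0 : 0 < Num.sqrt h by rewrite sqrtr_gt0.
  have p0 : 0 < Num.sqrt (@pi R) by rewrite sqrtr_gt0 pi_gt0.
  have A0 : 0 < Num.sqrt (2 : R) by rewrite sqrtr_gt0.
  have A2 : Num.sqrt (2 : R) ^+ 2 = 2 by rewrite sqr_sqrtr.
  have pp : Num.sqrt (@pi R) ^+ 2 = pi by rewrite sqr_sqrtr ?pi_ge0.
  have aa := sqr_sqrtr (ltW a0); have hh := sqr_sqrtr (ltW h0).
  rewrite -[X in 4 / X]pp.
  move: (h + a * z ^+ 2) k0 (Num.sqrt a) sa0 aa (Num.sqrt h) sh0 hh => k k0 s s0 <- q q0 <-.
  move: (Num.sqrt pi) p0 (Num.sqrt 2) A0 A2 => p p0 A A0 A2.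
  rewrite (_ : A * p * s * _ = A ^+ 2 * (p ^+ 2 * s * q)); last by ring.
  rewrite A2.
  by field; rewrite !gt_eqF.
- by apply: measurable_continuous_EFin; repeat cont_step.
- by move=> x; rewrite in_itv/= andbT => x0; rewrite lee_fin mulr_ge0 ?expR_ge0// exprn_ge0.
- by rewrite lee_fin divr_ge0 ?mulr_ge0// le_max ler01.
Qed.

Lemma measurable_radial a h D :
  measurable_fun D (fun z => (Num.max 1 z / (h + a * z ^+ 2) ^+ 2)%:E).
Proof.
apply/measurable_EFinP/measurable_funTS; apply: measurable_funM.
  exact: measurable_maxr.
apply: (measurableT_comp measurable_invr).
by apply: continuous_measurable_fun; repeat cont_step.
Qed.

(** The maximum switches at z = 1. Below, the primitive of (h + a z^2)^-2 has a rational part and an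
    arctangent, the first two terms; above, z (h + a z^2)^-2 has a rational primitive, the third. *)
Lemma integral_radial a h : 0 < a -> 0 < h ->
  (\int[mu]_(z in `[0%R, +oo[) (Num.max 1 z / (h + a * z ^+ 2) ^+ 2)%:E =
   ((2 * h * (h + a))^-1 + atan (Num.sqrt a / Num.sqrt h) / (2 * h * (Num.sqrt a * Num.sqrt h))
    + (2 * a * (h + a))^-1)%:E)%E.
Proof.
move=> a0 h0.
have k0 z : 0 < h + a * z ^+ 2 by rewrite ltr_pwDl// mulr_ge0 ?sqr_ge0// ltW.
have kn0 z : h + a * z ^+ 2 != 0 by rewrite gt_eqF.
have ck : continuous (fun z => h + a * z ^+ 2) by repeat cont_step.
have -> : `[0%R, +oo[%classic = `[0%R, 1%R]%classic `|` `]1%R, +oo[%classic :> set R.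
  apply/seteqP; split => x /=; rewrite !in_itv/= !andbT.
    by move=> ->; case: leP; [left|right].
  by case=> [/andP[]//|/ltW]; exact: le_trans.
have mf D := @measurable_radial a h D.
rewrite ge0_integral_setU//=; last 2 first.
- by move=> z _; rewrite lee_fin divr_ge0 ?exprn_ge0 ?(ltW (k0 _))// le_max ler01.
- by apply/disj_setPLR => x /=; rewrite !in_itv/= andbT => /andP[_ x1]; apply/negP; rewrite -leNgt.
rewrite EFinD; congr (_ + _)%E.
- pose F z := z / (2 * h * (h + a * z ^+ 2))
    + atan (z * (Num.sqrt a / Num.sqrt h)) / (2 * h * (Num.sqrt a * Num.sqrt h)).
  have dF (z : R) : is_derive z 1 F ((h + a * z ^+ 2) ^- 2).
    have dk : is_derive z 1 (fun z => 2 * h * (h + a * z ^+ 2)) (2 * h * (2 * a * z)).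
      by apply: is_derive_eq; rewrite /GRing.scale/=; ring.
    have d0 : 2 * h * (h + a * z ^+ 2) != 0 by rewrite !mulf_neq0// gt_eqF.
    have dki := is_deriveV (f := fun z => 2 * h * (h + a * z ^+ 2)) d0 dk.
    apply: is_derive_eq; rewrite /GRing.scale/=.
    have sa0 : 0 < Num.sqrt a by rewrite sqrtr_gt0.
    have sh0 : 0 < Num.sqrt h by rewrite sqrtr_gt0.
    have : h + a * z ^+ 2 != 0 by [].
    have aa := sqr_sqrtr (ltW a0); have hh := sqr_sqrtr (ltW h0).
    have : 1 + (z * (Num.sqrt a / Num.sqrt h)) ^+ 2 = (h + a * z ^+ 2) / h.
      by rewrite exprMn expr_div_n aa hh; field; rewrite gt_eqF.
    move=> -> k1; move: sa0 aa sh0 hh k1; move: (Num.sqrt a) (Num.sqrt h) => s q s0 <- q0 <- k1.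
    by field; rewrite exprMn k1 !gt_eqF.
  transitivity (\int[mu]_(z in `[0%R, 1%R]) ((h + a * z ^+ 2) ^- 2)%:E)%E.
    apply: eq_integral => z; rewrite inE/= in_itv/= => /andP[_ z1].
    by rewrite (max_idPl z1) div1r.
  rewrite (FTC2_is_derive _ _ dF)//.
    by rewrite /F expr1n expr0n/= !mulr0 !mul0r atan0 mul0r !addr0 subr0 mulr1 !mul1r.
  apply: continuous_invr => [z|]; first by rewrite expf_neq0.
  by repeat cont_step.
- rewrite integral_itv_obnd_cbnd; last exact: mf.
  pose F z := - (2 * a * (h + a * z ^+ 2))^-1.
  transitivity (\int[mu]_(z in `[1%R, +oo[) (z / (h + a * z ^+ 2) ^+ 2)%:E)%E.
    apply: eq_integral => z; rewrite inE/= in_itv/= andbT => z1.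
    by rewrite (max_idPr z1).
  have dF (z : R) : is_derive z 1 F (z / (h + a * z ^+ 2) ^+ 2).
    have dk : is_derive z 1 (fun z => 2 * a * (h + a * z ^+ 2)) (2 * a * (2 * a * z)).
      by apply: is_derive_eq; rewrite /GRing.scale/=; ring.
    have d0 : 2 * a * (h + a * z ^+ 2) != 0 by rewrite !mulf_neq0// gt_eqF.
    have dki := is_deriveV (f := fun z => 2 * a * (h + a * z ^+ 2)) d0 dk.
    apply: is_derive_eq; rewrite /GRing.scale/=.
    by field; rewrite ?kn0 (gt_eqF a0) ?kn0.
  have cF : continuous F.
    apply: continuous_oppr; apply: continuous_invr; last by repeat cont_step.
    by move=> z; rewrite !mulf_neq0// gt_eqF.
  rewrite (ge0_continuous_FTC2y (l := 0) (F := F))//.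
  + by rewrite /F -EFinB sub0r opprK expr1n mulr1.
  + move=> z z1; rewrite divr_ge0 ?exprn_ge0 ?(ltW (k0 _))//.
    exact: le_trans z1.
  + apply: continuous_subspaceT; repeat cont_step.
    by move=> z; rewrite expf_neq0.
  + rewrite -oppr0; apply: cvgN; apply/gtr0_cvgV0.
      by near=> z; rewrite !mulr_gt0.
    rewrite (_ : (fun z => _) = (fun y => y + 2 * a * h) \o (fun z => z ^+ 2 * (2 * a ^+ 2))).
      apply: (cvg_comp _ _ _ (cvg_addrr _)).
      by apply: gt0_cvgMly; [rewrite mulr_gt0// exprn_gt0|exact: cvgr_expr2].
    by apply/funext => z /=; ring.
  + by apply: cvg_at_right_filter; exact: cF.
  + by move=> z _; have [? <-] := dF z; rewrite derive1E.
- exact: mf.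
Unshelve. all: by end_near. Qed.

(** The quadrant is swept by the rays y = x z. Integrating x out first leaves an integral over the
    slope z, the source of the arctangent in [bm_cov]. *)
Lemma integral_gauss_cov a h : 0 < a -> 0 < h ->
  (\int[mu]_x \int[mu]_y (`|x| * `|x + y| * centered_pdf a x * centered_pdf h y)%:E =
   (bm_cov h a)%:E)%E.
Proof.
move=> a0 h0; rewrite gauss_cov_quadrant//.
have mpdf b : measurable_fun setT (centered_pdf b).
  by apply: continuous_measurable_fun; exact: continuous_centered_pdf.
pose G (p : R * R) : \bar R :=
  (p.1 * (4 * p.1 * Num.max p.1 (p.1 * p.2) * centered_pdf a p.1 * centered_pdf h (p.1 * p.2)))%:E.
(* [G] may be negative for x < 0. Its absolute value agrees with it for x >= 0 and is nonnegative
   everywhere, as the exchange requires. *)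
pose f p := `|G p|%E.
have mG : measurable_fun setT G.
  have m12 : measurable_fun setT (fun p : R * R => p.1 * p.2) by exact: measurable_funM.
  apply/measurable_EFinP; apply: measurable_funM => //.
  apply: measurable_funM; last exact: (measurableT_comp (mpdf h)).
  apply: measurable_funM; last exact: (measurableT_comp (mpdf a)).
  apply: measurable_funM; first exact: measurable_funM.
  exact: measurable_maxr.
have mf : measurable_fun setT f by exact: measurableT_comp.
have fG x z : 0 <= x -> f (x, z) = G (x, z).
  move=> x0; rewrite /f gee0_abs// lee_fin.
  by rewrite !mulr_ge0 ?centered_pdf_ge0// le_max x0.
transitivity (\int[mu]_(x in `[0%R, +oo[) \int[mu]_(z in `[0%R, +oo[) f (x, z))%E.
  apply: eq_integral => x; rewrite inE/= in_itv/= andbT => x0.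
  under [RHS]eq_integral do rewrite fG//.
  (* At x = 0 the substitution degenerates, but both integrands vanish. *)
  move: x0; rewrite le_eqVlt => /predU1P[<-|x0].
    rewrite !integral0_eq// => y _; rewrite /G/=; congr EFin; first by rewrite !(mulr0,mul0r).
    by rewrite mul0r.
  have mx : measurable_fun setT
      (fun y => (4 * x * Num.max x y * centered_pdf a x * centered_pdf h y)%:E).
    apply/measurable_EFinP; apply: measurable_funM => //; apply: measurable_funM => //.
    by apply: measurable_funM => //; exact: measurable_maxr.
  rewrite (lebesgue_affine_set (c := 0) (k := x) (E := `[0, +oo[%classic))//.
  - rewrite gtr0_norm// -ge0_integralZl//=.
    + by apply: eq_integral => z _; rewrite -EFinM /G/= add0r.
    + apply: measurable_funTS; apply: (measurableT_comp mx).
      by apply: measurable_funD => //; exact: measurable_funM.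
    + by move=> z _; rewrite lee_fin !mulr_ge0 ?centered_pdf_ge0 ?(ltW x0)// le_max (ltW x0).
    + by rewrite lee_fin ltW.
  - by rewrite gt_eqF.
  - by move=> z /=; rewrite !in_itv/= !andbT add0r pmulr_rge0.
  - by move=> y; rewrite lee_fin !mulr_ge0 ?centered_pdf_ge0 ?(ltW x0)// le_max (ltW x0).
have mquad : measurable [set p : R * R | `[0%R, +oo[%classic p.1 /\ `[0%R, +oo[%classic p.2].
  rewrite (_ : mkset _ = `[0%R, +oo[%classic `*` `[0%R, +oo[%classic)//.
  exact: measurableX.
have f0 p : (0 <= f p)%E by exact: abse_ge0.
rewrite (@tonelli_swap _ _ _ _ _ mu mu _ _ `[0%R, +oo[%classic (fun=> `[0%R, +oo[%classic)
  _ _ mquad mf f0); last by move=> x y; split=> -[].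
transitivity (\int[mu]_(z in `[0%R, +oo[)
  ((4 / pi * (a * h * Num.sqrt a * Num.sqrt h))%:E *
   (Num.max 1 z / (h + a * z ^+ 2) ^+ 2)%:E))%E.
  apply: eq_integral => z _; rewrite -EFinM -gauss_cov_radial//.
  by apply: eq_integral => x; rewrite inE/= in_itv/= andbT => x0; rewrite fG.
rewrite ge0_integralZl//=.
- rewrite integral_radial// -EFinM; congr EFin; rewrite /bm_cov.
  have sa0 : 0 < Num.sqrt a by rewrite sqrtr_gt0.
  have sh0 : 0 < Num.sqrt h by rewrite sqrtr_gt0.
  have ah : h + a != 0 by rewrite gt_eqF ?addr_gt0.
  move: (atan _) => A; move: (@pi R) (@pi_neq0 R) => p p0.
  move: sa0 sh0 (sqr_sqrtr (ltW a0)) (sqr_sqrtr (ltW h0)) ah.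
  move: (Num.sqrt a) (Num.sqrt h) => s q s0 q0 <- <- ah.
  by field; rewrite ah p0 !gt_eqF.
- exact: measurable_radial.
- move=> z _; rewrite lee_fin divr_ge0 ?le_max ?ler01// exprn_ge0//.
  by rewrite addr_ge0 ?(ltW h0)// mulr_ge0 ?sqr_ge0// ltW.
- by rewrite lee_fin !mulr_ge0 ?invr_ge0 ?pi_ge0// ltW.
Qed.

End gaussian_integrals.

(** * Independence and the moments of Brownian motion *)

Section mutual_independence.
Context d (Omega : measurableType d) (R : realType) (P : probability Omega R).
Context (I : choiceType) (F : I -> set (set Omega)).
Hypothesis indepF : mutually_independent P F.

Lemma mutually_independent2 (i j : I) (A B : set Omega) : i != j ->
  F i A -> F j B -> P (A `&` B) = (P A * P B)%E.
Proof.
move=> ij FA FB; pose C k := if k == i then A else B.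
have ji : (j == i) = false by rewrite eq_sym; apply/negbTE.
have := @indepF [fset i; j]%fset C.
rewrite (_ : \bigcap_(k in _) C k = A `&` B).
  rewrite big_fsetU1/= ?big_seq_fset1 ?inE// {2 3}/C eqxx ji; apply.
  by move=> k; rewrite !inE /C => /orP[]/eqP ->; rewrite ?eqxx ?ji.
apply/seteqP; split => [w h|w [Aw Bw] k /=].
  split; first by have := h i; rewrite /C eqxx; apply; rewrite /= !inE eqxx.
  by have := h j; rewrite /C ji; apply; rewrite /= !inE eqxx orbT.
by rewrite !inE /C => /orP[]/eqP ->; rewrite ?eqxx ?ji.
Qed.

Lemma mutually_independent3 (i j k : I) (A B C : set Omega) :
  i != j -> i != k -> j != k -> F i A -> F j B -> F k C ->
  P (A `&` (B `&` C)) = (P A * (P B * P C))%E.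
Proof.
move=> ij ik jk FA FB FC.
pose D l := if l == i then A else if l == j then B else C.
have ji : (j == i) = false by rewrite eq_sym; apply/negbTE.
have ki : (k == i) = false by rewrite eq_sym; apply/negbTE.
have kj : (k == j) = false by rewrite eq_sym; apply/negbTE.
have Di : D i = A by rewrite /D eqxx.
have Dj : D j = B by rewrite /D ji eqxx.
have Dk : D k = C by rewrite /D ki kj.
have := @indepF [fset i; j; k]%fset D.
rewrite (_ : \bigcap_(l in _) D l = A `&` (B `&` C)).
  rewrite -fsetUA !big_fsetU1/= ?inE ?negb_or ?ij ?ik ?jk// big_seq_fset1 Di Dj Dk; apply.
  by move=> l; rewrite !inE -?orbA => /or3P[]/eqP ->; rewrite ?Di ?Dj ?Dk.
apply/seteqP; split => [w h|w [Aw [Bw Cw]] l /=].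
  split; [|split].
  - by have := h i; rewrite Di; apply; rewrite /= !inE eqxx.
  - by have := h j; rewrite Dj; apply; rewrite /= !inE eqxx orbT.
  - by have := h k; rewrite Dk; apply; rewrite /= !inE eqxx orbT.
by rewrite !inE -?orbA => /or3P[]/eqP ->; rewrite ?Di ?Dj ?Dk.
Qed.

End mutual_independence.

Section brownian_moments.
Local Open Scope ereal_scope.
Context d (Omega : measurableType d) (R : realType) (P : probability Omega R).
Local Notation mu := (@lebesgue_measure R).

(** The change of variables is made with the Radon-Nikodym derivative of the law, which equals
    [centered_pdf a] almost everywhere because both have the same integral over every measurable
    set. *)
Lemma normal_law_integral (X : {RV P >-> R}) (a : R) (f : R -> \bar R) : (0 < a)%R ->
  (forall A : set R, measurable A -> P (X @^-1` A) = normal_prob 0 (Num.sqrt a) A) ->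
  measurable_fun setT f -> (forall x, 0 <= f x) ->
  \int[P]_w f (X w) = \int[mu]_x (f x * (centered_pdf a x)%:E).
Proof.
move=> a0 lawX mf f0.
have mX : measurable_fun setT (X : Omega -> measurableTypeR R).
  by move=> mT Y mY; exact: (@measurable_funPT _ _ _ _ X mT Y mY).
pose X' : {mfun Omega >-> measurableTypeR R} :=
  HB.pack (X : Omega -> measurableTypeR R) (isMeasurableFun.Build _ _ _ _ _ mX).
rewrite -(@ge0_integral_distribution _ _ _ _ _ P X')//.
transitivity (\int[normal_prob 0 (Num.sqrt a)]_x f x).
  by apply: eq_measure_integral => A mA _; exact: lawX.
have dom := @normal_prob_dominates R 0%R (Num.sqrt a).
rewrite -(Radon_Nikodym_SigmaFinite.change_of_variables dom)//.
have mpdf : measurable_fun setT (fun x => (centered_pdf a x)%:E).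
  by apply: measurable_continuous_EFin; exact: continuous_centered_pdf.
have mRN := Radon_Nikodym_SigmaFinite.f_integrable dom.
apply: ae_eq_integral => //.
- by apply: emeasurable_funM => //; exact: measurable_int mRN.
- exact: emeasurable_funM.
- apply: ae_eqe_mul2l; apply: integral_ae_eq => // E _ mE.
  rewrite -Radon_Nikodym_SigmaFinite.f_integral//= /normal_prob.
  by rewrite normal_pdf_centered.
Qed.

Variable (B : R -> {RV P >-> R}).
Hypothesis hB : brownian_motion B.

Let increment_measurable (s t : R) : measurable_fun setT (fun w => (B t w - B s w)%R).
Proof. exact: measurable_funB. Qed.

Let incr (s t : R) : {mfun Omega >-> R} := HB.pack (fun w => (B t w - B s w)%R)
  (isMeasurableFun.Build _ _ _ _ _ (increment_measurable s t)).

Let incr_law (s t : R) : (0 <= s)%R -> (s < t)%R -> forall A : set R, measurable A ->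
  P (incr s t @^-1` A) = normal_prob 0 (Num.sqrt (t - s)) A.
Proof. by move=> s0 st A mA; rewrite -(brownian_gaussian hB s0 st mA). Qed.

Let incr0 : {ae P, forall w, forall t, B t w = incr 0 t w}.
Proof. by apply: filterS (brownian_init hB) => w w0 t /=; rewrite w0 subr0. Qed.

Lemma brownian_abs_moment (u : R) : (0 <= u)%R ->
  \int[P]_w (`|B u w|%:E) = (Num.sqrt (2 / pi) * Num.sqrt u)%:E.
Proof.
rewrite le_eqVlt => /predU1P[<-|u0].
  rewrite sqrtr0 mulr0 (@ge0_integral_ae_eq _ _ _ _ _ (cst 0)) ?integral0//.
  by apply: filterS (brownian_init hB) => w /= ->; rewrite normr0.
rewrite (@ge0_integral_ae_eq _ _ _ _ _ (fun w => `|incr 0 u w|%:E))//; last first.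
  by apply: filterS incr0 => w ->.
have law0 := incr_law (lexx 0%R) u0; rewrite subr0 in law0.
rewrite (normal_law_integral (f := fun x => `|x|%:E) u0 law0)//; last first.
  by apply/measurable_EFinP; exact: normr_measurable.
by under eq_integral do rewrite -EFinM; rewrite integral_norm_centered_pdf.
Qed.

(** With X1 and X2 the increments over [[0, a]] and [[a, a + h]], the product is |X1| |X1 + X2|
    almost surely, and independence turns its mean into a double Gaussian integral. *)
Lemma brownian_product_moment (a h : R) : (0 <= a)%R -> (0 < h)%R ->
  \int[P]_w (`|B a w| * `|B (a + h) w|)%:E = (bm_cov h a)%:E.
Proof.
rewrite le_eqVlt => /predU1P[<-|a0] h0.
  rewrite (@ge0_integral_ae_eq _ _ _ _ _ (cst 0)) ?integral0//.
    by rewrite /bm_cov sqrtr0 !mul0r addr0 mulr0.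
  by apply: filterS (brownian_init hB) => w /= ->; rewrite normr0 mul0r.
have ah : (a < a + h)%R by rewrite ltrDl.
pose X1 := incr 0 a; pose X2 := incr a (a + h).
pose F (p : R * (R * R)) := (`|p.2.1| * `|p.2.1 + p.2.2|)%:E.
(* A constant first component brings the two increments under the lemma on independent triples. *)
pose X0 : {mfun Omega >-> R} := cst 0%R.
transitivity (\int[P]_w F (X0 w, (X1 w, X2 w))).
  apply: ge0_integral_ae_eq => [w|w|]; [by rewrite lee_fin mulr_ge0..|].
  apply: filterS (brownian_init hB) => w w0.
  by rewrite /F/= w0 !subr0 [(B a w + _)%R]addrC subrK.
have mF : measurable_fun setT F.
  apply/measurable_EFinP; apply: measurable_funM; apply: measurableT_comp => //.
    by apply: (measurableT_comp (@measurable_fst _ _ R R)).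
  by apply: measurable_funD;
    [apply: (measurableT_comp (@measurable_fst _ _ R R))
    |apply: (measurableT_comp (@measurable_snd _ _ R R))].
transitivity (\int[P]_w \int[P]_w1 \int[P]_w2 F (X0 w, (X1 w1, X2 w2))).
  apply: (@independent_triple_integral _ _ _ _ _ _ _ _ _ P X0 X1 X2 F) => //.
  move=> A C D mA mC mD.
  have PCD : P (X1 @^-1` C `&` X2 @^-1` D) = P (X1 @^-1` C) * P (X2 @^-1` D).
    (* The times 0, a, a + h, a + h, ...; increments 0 and 1 are X1 and X2. *)
    pose t i : R := (if i is i'.+1 then if i' is _.+1 then a + h else a else 0)%R.
    have t0 : (0 <= t 0%N)%R by [].
    have tn : nondecreasing_seq t.
      by apply/nondecreasing_seqP => -[|[|n]]/=; rewrite ?(ltW a0) ?(ltW ah).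
    apply: (mutually_independent2 (brownian_increments hB t0 tn) (i := 0%N) (j := 1%N)) => //.
      by exists C => //; rewrite setTI.
    by exists D => //; rewrite setTI.
  rewrite (_ : X0 @^-1` A = if 0%R \in A then setT else set0); last exact: preimage_cst.
  case: ifPn => _; first by rewrite setTI probability_setT mul1e.
  by rewrite set0I measure0 mul0e.
  by move=> p; rewrite lee_fin mulr_ge0.
transitivity (\int[P]_w cst (\int[P]_w1 \int[P]_w2 F (0%R, (X1 w1, X2 w2))) w) => //.
rewrite integral_cst//.
rewrite [X in _ * X](_ : _ = 1) ?mule1 -?(integral_gauss_cov a0 h0); last exact: probability_setT.
have law1 := incr_law (lexx 0%R) a0; rewrite subr0 in law1.
have law2 := incr_law (ltW a0) ah; rewrite (_ : (a + h - a = h)%R) in law2; last by ring.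
have mpdf : measurable_fun setT (centered_pdf h).
  by apply: continuous_measurable_fun; exact: continuous_centered_pdf.
pose G (p : R * R) := (`|p.1| * `|p.1 + p.2| * centered_pdf h p.2)%:E.
have mG : measurable_fun setT G.
  apply/measurable_EFinP; apply: measurable_funM; last exact: measurableT_comp.
  by apply: measurable_funM; apply: measurableT_comp => //; exact: measurable_funD.
have G0 p : 0 <= G p by rewrite lee_fin !mulr_ge0 ?centered_pdf_ge0.
pose I x := \int[mu]_y G (x, y).
have mI : measurable_fun setT I by exact: (measurable_fun_fubini_tonelli_F (m2 := mu) _ mG G0).
have I0 x : 0 <= I x by exact: integral_ge0.
transitivity (\int[P]_w1 I (X1 w1)).
  apply: eq_integral => w1 _; rewrite /F/=.
  rewrite [LHS](_ : _ = \int[mu]_y ((`|X1 w1| * `|X1 w1 + y|)%:E * (centered_pdf h y)%:E))//.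
  apply: (normal_law_integral (f := fun y => (`|X1 w1| * `|X1 w1 + y|)%:E) h0 law2)
    => [|y]; last by rewrite lee_fin mulr_ge0.
  apply/measurable_EFinP; apply: measurable_funM => //; apply: measurableT_comp => //.
  exact: measurable_funD.
rewrite (normal_law_integral a0 law1)//; apply: eq_integral => x _.
rewrite /I muleC -ge0_integralZl//=.
- by apply: eq_integral => y _; rewrite -EFinM; congr EFin; ring.
- by apply: (measurableT_comp mG); exact: measurable_pair1.
- by rewrite lee_fin centered_pdf_ge0.
Qed.

End brownian_moments.

(** * Ages of the Poisson process *)

Lemma rc_version_ge0 (R : realType) (T : Type) (X : R -> T -> \bar R) p :
  (forall t w, (0 <= X t w)%E) -> (0 <= rc_version X p)%E.
Proof.
move=> X0; rewrite /rc_version limn_esup_lim; apply: lime_ge.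
  exact: is_cvg_esups.
apply: nearW => m; apply: le_trans (X0 (rgrid m p.1) p.2) _.
by apply: ereal_sup_ubound; exists m => /=.
Qed.

Section counting_path.
Context {R : realType} (n : R -> nat).
Hypothesis n_mono : forall s t, 0 <= s -> s <= t -> (n s <= n t)%N.
Hypothesis n_rc : forall t, 0 <= t -> \forall u \near t^'+, n u = n t.

Let reset_set t := [set u | 0 <= u /\ (n t <= n u)%N].

Lemma last_reset_ge0 t : 0 <= t -> 0 <= inf (reset_set t).
Proof.
by move=> t0; apply: lb_le_inf; [exists t|move=> u []].
Qed.

Lemma last_reset_le t : 0 <= t -> inf (reset_set t) <= t.
Proof. by move=> t0; apply: ge_inf => //; exists 0 => u []. Qed.

(** The infimum tau is attained: points of the set come arbitrarily close to tau from the right,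
    where n keeps the value n(tau) by right continuity. Hence n(tau) >= n(t), and monotonicity makes
    n constant on [[tau, t]]. *)
Lemma last_resetP t u : 0 <= u -> u <= t ->
  (n u = n t) <-> (inf (reset_set t) <= u).
Proof.
move=> u0 ut; have t0 := le_trans u0 ut.
split=> [nut|tau_u].
  by apply: ge_inf; [exists 0 => v []|split; rewrite ?nut].
apply/eqP; rewrite eqn_leq n_mono//=.
set tau := inf (reset_set t) in tau_u *.
have tau0 : 0 <= tau by exact: last_reset_ge0.
suff : (n t <= n tau)%N by move=> h; rewrite (leq_trans h)// n_mono.
have [e /= e0 etau] := n_rc tau0.
have hinf : has_inf (reset_set t) by split; [exists t|exists 0 => v []].
have [v [v0 ntv] vtau] := inf_adherent e0 hinf.
have tauv : tau <= v by apply: ge_inf; [exists 0 => ? []|].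
move: tauv; rewrite le_eqVlt => /predU1P[->//|tauv].
rewrite -(etau v)//=; rewrite /ball_/= distrC ger0_norm ?subr_ge0 ?ltW//.
by rewrite ltrBlDl.
Qed.

End counting_path.

Lemma measurable_id_generated d (T : measurableType d) (G : set (set T)) :
  G `<=` measurable -> measurable_fun setT (fun x : T => x : g_sigma_algebraType G).
Proof.
move=> Gm _ A mA; rewrite setTI preimage_id.
by apply: (smallest_sub _ Gm) mA; exact: sigma_algebra_measurable.
Qed.

Lemma integral_sqrt_itv (R : realType) (x : R) :
  (\int[@lebesgue_measure R]_(y in `[0%R, Num.sqrt x]) 1%:E = (Num.sqrt x)%:E)%E.
Proof.
rewrite integral_cst//= mul1e lebesgue_measure_itv/= lte_fin oppr0 adde0.
have := sqrtr_ge0 x; rewrite le_eqVlt => /predU1P[<-|->//].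
by rewrite ltxx.
Qed.

(** * A process as a random element *)

Section process_space.
Context d (Omega : measurableType d) (R : realType) (P : probability Omega R)
  d' (E : measurableType d') (X : R -> {RV P >-> E}).

(** The carrier is still Omega, with the sigma-algebra generated by the process at times t >= 0.
    Measurable functions on it are functionals of the process alone, and the identity of Omega
    becomes a random element to which independence applies. *)
Definition process_space := g_sigma_algebraType
  (\bigcup_(t in [set t : R | 0 <= t]) rv_sigma_algebra (X t)).

Lemma measurable_process (t : R) : 0 <= t ->
  measurable_fun setT (X t : process_space -> E).
Proof.
by move=> t0 _ A mA; apply: sub_sigma_algebra; exists t => //; exists A.
Qed.

Lemma measurable_to_process_space :
  measurable_fun setT (fun w : Omega => w : process_space).
Proof.
apply: measurable_id_generated => _ [u /= u0] [A mA <-].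
by rewrite setTI; exact: measurable_funPTI.
Qed.

End process_space.

(** * Joint law of the ages at one and two times *)

Section poisson_ages.
Context d (Omega : measurableType d) (R : realType) (P : probability Omega R)
  (r : R) (N : R -> {RV P >-> nat}).
Hypothesis r0 : 0 < r.
Hypothesis hN : poisson_process r N.

Lemma measure_ae_eq (A B : set Omega) : measurable A -> measurable B ->
  {ae P, forall w, A w <-> B w} -> P A = P B.
Proof.
move=> mA mB AB.
rewrite -[A]setIT -[B]setIT -!integral_indic//.
apply: ge0_integral_ae_eq => [w|w|]; [by rewrite lee_fin..|].
apply: filterS AB => w ABw; rewrite !indicE.
suff -> : (w \in A) = (w \in B) by [].
by apply/idP/idP; rewrite !inE => /ABw.
Qed.

Let measurable_count_eq (s t : R) : measurable [set w | N s w = N t w].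
Proof.
rewrite (_ : mkset _ = \bigcup_k ((N s @^-1` [set k]) `&` (N t @^-1` [set k]))).
  by apply: bigcup_measurable => k _; apply: measurableI; exact: measurable_funPTI.
by apply/seteqP; split => [w /= st|w [k _ [/= -> ->]]]; [exists (N s w)|].
Qed.

Lemma prob_no_point (s t : R) : 0 <= s -> s <= t ->
  P [set w | N s w = N t w] = (expR (- r * (t - s)))%:E.
Proof.
move=> s0; rewrite le_eqVlt => /predU1P[<-|st].
  rewrite subrr mulr0 expR0 (_ : mkset _ = setT) ?probability_setT//.
  by apply/seteqP; split.
have := poisson_law hN s0 st 0.
rewrite /poisson_pmf mulr_gt0 ?subr_gt0// expr0 fact0 invr1 !mul1r mulNr => <-.
by congr (P _); apply/seteqP; split => w /=; rewrite addn0.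
Qed.

Lemma prob_no_point2 (s t u v : R) : 0 <= s -> s <= t -> t <= u -> u <= v ->
  P ([set w | N s w = N t w] `&` [set w | N u w = N v w]) =
  (expR (- r * (t - s)) * expR (- r * (v - u)))%:E.
Proof.
move=> s0 st tu uv.
(* The times s, t, u, v, v, ...; increments 0 and 2 are the two blocks, increment 1 the gap between
   them. *)
pose T i : R := if i is i1.+1 then if i1 is i2.+1 then if i2 is _.+1 then v else u else t else s.
have T0 : 0 <= T 0%N by [].
have Tn : nondecreasing_seq T by apply/nondecreasing_seqP => -[|[|[|i]]].
have u0 : 0 <= u := le_trans s0 (le_trans st tu).
rewrite EFinM -(prob_no_point s0 st) -(prob_no_point u0 uv).
apply: (mutually_independent2 (poisson_increments hN T0 Tn) (i := 0%N) (j := 2%N)) => //.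
  exists [set 0] => //; rewrite setTI; apply/seteqP; split => w /=.
    by move/eqP; rewrite subr_eq0 eqr_nat => /eqP.
  by move=> ->; rewrite subrr.
exists [set 0] => //; rewrite setTI; apply/seteqP; split => w /=.
  by move/eqP; rewrite subr_eq0 eqr_nat => /eqP.
by move=> ->; rewrite subrr.
Qed.

Definition regular_count (w : Omega) : Prop :=
  (forall s t, 0 <= s -> s <= t -> (N s w <= N t w)%N) /\
  (forall t, 0 <= t -> \forall u \near t^'+, N u w = N t w).

Lemma ae_regular_count : {ae P, forall w, regular_count w}.
Proof.
apply: filterS2 (poisson_nondecreasing hN) (poisson_right_continuous hN).
by move=> w ? ?; split.
Qed.

Let count_space := process_space N.

(** As a function of u in [[0, t]], almost surely the indicator of the times since the last reset
    before t, whose total length is the age at t. *)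
Definition same_count t u w : \bar R := (\1_[set w | N u w = N t w] w)%:E.

Lemma measurable_same_count t u : 0 <= t -> 0 <= u ->
  measurable_fun setT (same_count t u : count_space -> \bar R).
Proof.
move=> t0 u0; apply/measurable_EFinP/measurable_indic.
rewrite (_ : mkset _ = \bigcup_k ((N u @^-1` [set k]) `&` (N t @^-1` [set k]))).
  apply: bigcup_measurable => k _; apply: measurableI.
    by rewrite -[X in measurable X]setTI; exact: measurable_process.
  by rewrite -[X in measurable X]setTI; exact: measurable_process.
by apply/seteqP; split => [w /= st|w [k _ [/= -> ->]]]; [exists (N u w)|].
Qed.

(* A version of the age t - poisson_point N (N t w) w that is measurable with
   respect to the Poisson process alone. *)
Definition age (t : R) (w : Omega) : R :=
  fine (\int[lebesgue_measure]_(u in `[0%R, t]) rc_version (same_count t) (u, w)).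

Lemma age_ge0 t w : 0 <= age t w.
Proof.
apply/fine_ge0/integral_ge0 => u _; apply: rc_version_ge0 => v w'.
by rewrite lee_fin.
Qed.

Lemma measurable_age (t : R) : 0 <= t ->
  measurable_fun setT (age t : count_space -> R).
Proof.
move=> t0; apply: measurableT_comp => //.
apply: (@measurable_integral_section _ _ _ _ _ (@lebesgue_measure R)
  (fun _ : count_space => `[0%R, t]%classic)
  (fun p => rc_version (same_count t) (p.2, p.1))).
- rewrite (_ : mkset _ = snd @^-1` `[0, t]%classic)//.
  by rewrite -[X in measurable X]setTI; exact: measurable_snd.
- apply: (measurableT_comp (f := rc_version (same_count t : R -> count_space -> \bar R))
    (g := fun p : count_space * R => (p.2, p.1))).
    by apply: measurable_rc_version => u u0; exact: measurable_same_count.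
  exact/measurable_fun_pair.
- by move=> p; apply: rc_version_ge0 => u w; rewrite lee_fin.
Qed.

Lemma age_regular w t : regular_count w -> 0 <= t ->
  age t w = t - poisson_point N (N t w) w.
Proof.
move=> [mono rc] t0; rewrite /age.
set tau := poisson_point _ _ _.
have tau0 : 0 <= tau := last_reset_ge0 (fun u => N u w) t0.
have taut : tau <= t := last_reset_le (fun u => N u w) t0.
transitivity (fine (\int[lebesgue_measure]_(u in `[0%R, t])
    (\1_(`[tau, t]%classic : set R) u)%:E)).
  congr fine; apply: eq_integral => u; rewrite inE/= in_itv/= => /andP[u0 ut].
  have sc v : 0 <= v -> (v <= t) -> same_count t v w = (\1_(`[tau, t]%classic : set R) v)%:E.
    move=> v0 vt; rewrite /same_count !indicE; congr (nat_of_bool _)%:R%:E.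
    have := last_resetP mono rc v0 vt => /= hv.
    apply/idP/idP; rewrite !inE/= in_itv/= vt andbT; last by move/hv.
    by move/hv.
  rewrite rc_versionE//; first exact: sc.
  apply: cvg_near_cst; apply: filterS (rc _ u0) => v vu.
  rewrite /same_count !indicE; congr (nat_of_bool _)%:R%:E.
  by apply/idP/idP; rewrite !inE/= vu.
rewrite integral_indic//= setIidl; last first.
  by move=> u /=; rewrite !in_itv/= => /andP[tu ->]; rewrite (le_trans tau0).
rewrite lebesgue_measure_itv/= lte_fin; case: ltP => // tt.
by rewrite /= (_ : t = tau) ?subrr//; apply/eqP; rewrite eq_le tt.
Qed.

Lemma age_geP w t x : regular_count w -> 0 <= x -> x <= t ->
  (x <= age t w) <-> (N (t - x) w = N t w).
Proof.
move=> rw x0 xt; rewrite age_regular ?(le_trans x0)//.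
have [mono rc] := rw.
have tx0 : 0 <= t - x by rewrite subr_ge0.
have txt : t - x <= t by rewrite gerBl.
have := last_resetP mono rc tx0 txt; rewrite /poisson_point => hv.
by rewrite hv; split; rewrite lerBrDr addrC -lerBrDr.
Qed.

Lemma age_le w t : regular_count w -> 0 <= t -> age t w <= t.
Proof.
move=> rw t0; rewrite age_regular// gerBl.
exact: (last_reset_ge0 (fun u => N u w) t0).
Qed.

Lemma measurable_age_Omega t : 0 <= t -> measurable_fun setT (age t).
Proof.
move=> t0; exact: (measurableT_comp (measurable_age t0) (@measurable_to_process_space _ _ _ _ _ _ N)).
Qed.

Let measurable_age_ge t x : 0 <= t -> measurable [set w | x <= age t w].
Proof.
by move=> t0; apply: measurable_set_bool; apply: measurable_fun_ler => //; exact: measurable_age_Omega.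
Qed.

Local Notation mu := (@lebesgue_measure R).

(** The layers run over the whole half-line because the age is bounded by s only almost surely; the
    range is cut down once the probability of a layer is known. *)
Lemma age_layers s (D : set Omega) (G : Omega -> \bar R) (k : R -> R) :
  0 <= s -> measurable D -> measurable_fun setT G -> measurable_fun setT k ->
  (forall w, (0 <= G w)%E) -> (forall y, 0 <= k y) ->
  (\int[P]_(w in D) \int[mu]_(y in `[0%R, Num.sqrt (age s w)]) (G w * (k y)%:E) =
   \int[mu]_(y in `[0%R, +oo[) \int[P]_(w in D `&` [set w | y ^+ 2 <= age s w]%R)
      (G w * (k y)%:E))%E.
Proof.
move=> s0 mD mG mk G0 k0.
apply: (@tonelli_swap _ _ _ _ _ P mu D (fun w => `[0%R, Num.sqrt (age s w)]%classic)
  `[0%R, +oo[%classic (fun y => D `&` [set w | y ^+ 2 <= age s w])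
  (fun p => G p.1 * (k p.2)%:E)%E).
- move=> w y; rewrite /= (in_itv_sqrt y (age_ge0 s w)) in_itv/= andbT.
  by split=> [[Dw /andP[]]|[y0 [Dw ya]]]//; rewrite y0 ya.
- rewrite (_ : mkset _ = (fst @^-1` D) `&` [set p : Omega * R | (0 <= p.2) && (p.2 ^+ 2 <= age s p.1)]).
    apply: measurableI.
      by rewrite -[X in measurable X]setTI; exact: measurable_fst.
    apply: measurable_set_bool; apply: measurable_and; apply: measurable_fun_ler => //.
      exact: measurable_funX.
    by apply: measurableT_comp (measurable_age_Omega s0) _.
  by apply/seteqP; split => p /=; rewrite (in_itv_sqrt _ (age_ge0 s p.1)).
- apply: emeasurable_funM; first exact: measurableT_comp.
  by apply/measurable_EFinP; exact: measurableT_comp.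
- by move=> p; rewrite mule_ge0 ?lee_fin.
Qed.

(** Here c is the tail of the age at s within the event D, required up to s only: the layers beyond
    s are null. *)
Lemma integral_age_layers s (D : set Omega) (k c : R -> R) :
  0 <= s -> measurable D -> measurable_fun setT k -> (forall y, 0 <= k y) ->
  (forall x, 0 <= x -> x <= s -> P (D `&` [set w | x <= age s w]) = (c x)%:E) ->
  (\int[P]_(w in D) \int[mu]_(y in `[0%R, Num.sqrt (age s w)]) (k y)%:E =
   \int[mu]_(y in `[0%R, Num.sqrt s]) (k y * c (y ^+ 2))%:E)%E.
Proof.
move=> s0 mD mk k0 Pc.
transitivity (\int[P]_(w in D) \int[mu]_(y in `[0%R, Num.sqrt (age s w)])
    (cst 1 w * (k y)%:E))%E.
  by apply: eq_integral => w _; apply: eq_integral => y _; rewrite mul1e.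
rewrite age_layers// [LHS]integral_mkcond [RHS]integral_mkcond.
apply: eq_integral => y _; rewrite !patchE.
have [y0|y0] := leP 0 y; last first.
  by rewrite !memNset//= in_itv/= ?andbT leNgt y0.
rewrite mem_set/= ?in_itv/= ?y0//.
under eq_integral do rewrite mul1e.
rewrite integral_cst; last by apply: measurableI => //; exact: measurable_age_ge.
case: ifPn.
  rewrite inE/= in_itv_sqrt// y0 /= => ys.
  by rewrite EFinM -Pc// sqr_ge0.
rewrite notin_setE/= in_itv_sqrt// y0/= => /negP; rewrite -ltNge => sy.
rewrite (_ : P _ = 0%E) ?mule0// -(measure0 P); apply: measure_ae_eq => //.
  by apply: measurableI => //; exact: measurable_age_ge.
apply: filterS ae_regular_count => w rw; split=> // -[_ /=].
by rewrite leNgt (le_lt_trans (age_le rw s0)).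
Qed.

Let age_eventE t x : 0 <= x -> x <= t ->
  {ae P, forall w, x <= age t w <-> N (t - x) w = N t w}.
Proof.
by move=> x0 xt; apply: filterS ae_regular_count => w rw; exact: age_geP.
Qed.

Lemma integral_sqrt_age t : 0 <= t ->
  (\int[P]_w (Num.sqrt (age t w))%:E =
   \int[mu]_(y in `[0%R, Num.sqrt t]) (expR (- r * y ^+ 2))%:E)%E.
Proof.
move=> t0.
transitivity (\int[P]_w \int[mu]_(y in `[0%R, Num.sqrt (age t w)]) 1%:E)%E.
  by apply: eq_integral => w _; rewrite integral_sqrt_itv.
rewrite (integral_age_layers (k := cst 1) (c := fun x => expR (- r * x)))//.
  by under eq_integral do rewrite mul1r.
move=> x x0 xt; rewrite setTI.
rewrite (measure_ae_eq (B := [set w | N (t - x) w = N t w]))//.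
- by rewrite prob_no_point ?subr_ge0 ?gerBl// opprB addrC subrK.
- exact: measurable_age_ge.
- exact: age_eventE.
Qed.

(** With no reset in []s, t]], an age of at least x at time s means no point in []s - x, t]], an
    event of probability e^(-r (x + t - s)). *)
Lemma integral_bm_cov_age s t : 0 <= s -> s < t ->
  (\int[P]_(w in [set w | N s w = N t w]) (bm_cov (t - s) (age s w))%:E =
   \int[mu]_(y in `[0%R, Num.sqrt s]) same_piece_density r (t - s) y)%E.
Proof.
move=> s0 st; have h0 : 0 < t - s by rewrite subr_gt0.
have mk : measurable_fun setT (bm_kernel (t - s)).
  by apply: (measurableT_comp measurable_bm_kernel (g := fun y => (y, t - s)));
     exact/measurable_fun_pair.
transitivity (\int[P]_(w in [set w | N s w = N t w])
    \int[mu]_(y in `[0%R, Num.sqrt (age s w)]) (bm_kernel (t - s) y)%:E)%E.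
  by apply: eq_integral => w _; rewrite integral_bm_kernel// age_ge0.
rewrite (integral_age_layers (c := fun x => expR (- r * (x + (t - s)))))//.
- apply: eq_integral => y _; rewrite /same_piece_density mulrDr expRD.
  by congr EFin; ring.
- by move=> y; exact: bm_kernel_ge0.
- move=> x x0 xs.
  have sx0 : 0 <= s - x by rewrite subr_ge0.
  rewrite (measure_ae_eq (B := [set w | N (s - x) w = N t w]))//.
  + by rewrite prob_no_point//; [congr (expR (_ * _))%:E; ring|lra].
  + by apply: measurableI => //; exact: measurable_age_ge.
  + apply: filterS2 ae_regular_count (age_eventE x0 xs) => w [mono _] ax.
    split=> [[/= <- /ax]//|/= sxt].
    have st' : N s w = N t w.
      by apply/eqP; rewrite eqn_leq (mono _ _ s0 (ltW st))/= -sxt mono// gerBl.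
    by split => //=; apply/ax; rewrite sxt st'.
Qed.

(** As z <= t - s, the blocks []s - x, s]] and []t - z, t]] are disjoint. Up to a null set, the
    event that both are empty splits into E, with a point in []s, t]], and F, with no point in []s -
    x, t]]; the claim is the difference of two known probabilities. *)
Let prob_ages s t x z : 0 <= x -> x <= s -> s <= t -> 0 <= z -> z <= t - s ->
  P ([set w | N s w != N t w] `&` [set w | z <= age t w] `&` [set w | x <= age s w]) =
  (expR (- r * x) * (expR (- r * z) - expR (- r * (t - s))))%:E.
Proof.
move=> x0 xs st z0 zts.
have s0 : 0 <= s := le_trans x0 xs.
have t0 : 0 <= t := le_trans s0 st.
have sx0 : 0 <= s - x by rewrite subr_ge0.
have sxs : s - x <= s by rewrite gerBl.
have stz : s <= t - z by rewrite lerBrDr addrC -lerBrDr.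
have tzt : t - z <= t by rewrite gerBl.
have zt : z <= t by apply: le_trans zts _; rewrite gerBl.
have mD : measurable [set w | N s w != N t w].
  rewrite (_ : mkset _ = ~` [set w | N s w = N t w]); first exact: measurableC.
  by apply/seteqP; split => w /=; [move/eqP|move=> ?; exact/eqP].
set E := _ `&` _.
have mE : measurable E by apply: measurableI; [apply: measurableI => //|]; exact: measurable_age_ge.
set F := [set w | N (s - x) w = N s w] `&` [set w | N s w = N t w].
have PF : P F = _ := prob_no_point2 sx0 sxs (lexx s) st.
have mF : measurable F by exact: measurableI.
have PEF : P (E `|` F) = (P E + P F)%E.
  apply: measureU => //.
  by apply/seteqP; split => // w [[[/eqP]]] ? _ _ [].
have := prob_no_point2 sx0 sxs stz tzt.
rewrite (measure_ae_eq (B := E `|` F)).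
- rewrite PEF PF => PE.
  have fE : P E \is a fin_num by exact: fin_num_measure.
  rewrite -(fineK fE) -EFinD in PE *; move: PE => [PE]; congr EFin.
  move: PE; rewrite (_ : s - (s - x) = x); last by ring.
  by rewrite (_ : t - (t - z) = z); [move=> PE; lra|ring].
- exact: measurableI.
- exact: measurableU.
- apply: filterS3 ae_regular_count (age_eventE x0 xs) (age_eventE z0 zt) => w [mono _] ax az.
  split=> [[/= sx tz]|].
    case: (eqVneq (N s w) (N t w)) => st'; [by right|left].
    by split; [split=> //; apply/az|apply/ax].
  move=> [[[_ /= /az tz] /= /ax sx]|[/= sx st']]; first by split.
  split=> //=; apply/eqP; rewrite eqn_leq mono//=; last by rewrite (le_trans s0).
  by rewrite -st' mono.
Qed.

(** One layer-cake formula per age: for t with the square root of the age at s as weight, then for s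
    on the event cut out by the layer at t. The product form of [prob_ages] separates the two
    integrals. *)
Lemma integral_sqrt_ages s t : 0 <= s -> s < t ->
  (\int[P]_(w in [set w | N s w != N t w])
     (Num.sqrt (age s w) * Num.sqrt (age t w))%:E =
   (\int[mu]_(y in `[0%R, Num.sqrt s]) (expR (- r * y ^+ 2))%:E) *
   \int[mu]_(z in `[0%R, Num.sqrt (t - s)])
      (expR (- r * z ^+ 2) - expR (- r * (t - s)))%:E)%E.
Proof.
move=> s0 st; set D := [set w | N s w != N t w]; set h := t - s.
have t0 : 0 <= t := le_trans s0 (ltW st).
have h0 : 0 <= h by rewrite subr_ge0 ltW.
have mD : measurable D.
  rewrite (_ : D = ~` [set w | N s w = N t w]); first exact: measurableC.
  by apply/seteqP; split => w /=; [move/eqP|move=> ?; exact/eqP].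
pose G w := (Num.sqrt (age s w))%:E.
have mG : measurable_fun setT G.
  apply/measurable_EFinP; apply: measurableT_comp; first exact: measurable_sqrtr.
  exact: measurable_age_Omega.
have G0 w : (0 <= G w)%E by rewrite lee_fin sqrtr_ge0.
transitivity (\int[P]_(w in D) \int[mu]_(z in `[0%R, Num.sqrt (age t w)]) (G w * 1%:E))%E.
  apply: eq_integral => w _; rewrite ge0_integralZl//=.
  by rewrite integral_sqrt_itv EFinM.
rewrite (age_layers (k := cst 1))//.
set E := (\int[mu]_(y in `[0%R, Num.sqrt s]) (expR (- r * y ^+ 2))%:E)%E.
have E0 : (0 <= E)%E by apply: integral_ge0 => y _; rewrite lee_fin expR_ge0.
have c0 z : `[0, Num.sqrt h]%classic z -> 0 <= expR (- r * z ^+ 2) - expR (- r * h).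
  rewrite /= in_itv_sqrt// => /andP[z0 zh].
  by rewrite subr_ge0 ler_expR !mulNr lerN2 ler_pM2l.
have mc : measurable_fun setT (fun z : R => (expR (- r * z ^+ 2) - expR (- r * h))%:E).
  apply/measurable_EFinP; apply: measurable_funB => //.
  apply: measurableT_comp => //; apply: measurable_funM => //; exact: measurable_funX.
transitivity (\int[mu]_(z in `[0%R, Num.sqrt h])
    (E * (expR (- r * z ^+ 2) - expR (- r * h))%:E))%E; last first.
  by rewrite ge0_integralZl//; exact: measurable_funTS.
rewrite [LHS]integral_mkcond [RHS]integral_mkcond.
apply: eq_integral => z _; rewrite !patchE.
have [z0|z0] := leP 0 z; last first.
  by rewrite !memNset//= in_itv/= ?andbT leNgt z0.
rewrite mem_set/= ?in_itv/= ?z0//.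
under eq_integral do rewrite mule1.
case: ifPn.
  move=> /set_mem zh; have := zh; rewrite /= in_itv_sqrt// z0 /= => zh'.
  transitivity (\int[P]_(w in D `&` [set w | z ^+ 2 <= age t w]%R)
     \int[mu]_(y in `[0%R, Num.sqrt (age s w)]) 1%:E)%E.
    by apply: eq_integral => w _; rewrite integral_sqrt_itv.
  rewrite (integral_age_layers (k := cst 1)
    (c := fun x => expR (- r * x) * (expR (- r * z ^+ 2) - expR (- r * h))))//.
  - under eq_integral do rewrite mul1r EFinM.
    rewrite ge0_integralZr//= ?lee_fin ?c0//.
    apply/measurable_EFinP; apply: measurable_funTS; apply: measurableT_comp => //.
    by apply: measurable_funM => //; exact: measurable_funX.
  - by apply: measurableI => //; exact: measurable_age_ge.
  - by move=> x x0 xs; rewrite prob_ages ?sqr_ge0 ?(ltW st).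
(* A layer with z^2 > t - s is null: an age exceeding t - s at time t would mean no reset since
   s. *)
rewrite notin_setE/= in_itv_sqrt// z0/= => /negP; rewrite -ltNge => hz.
rewrite null_set_integral//.
- by apply: measurableI => //; exact: measurable_age_ge.
- exact: measurable_funTS.
- rewrite -(measure0 P); apply: measure_ae_eq => //.
    by apply: measurableI => //; exact: measurable_age_ge.
  have ht : h <= t by rewrite gerBl.
  apply: filterS2 ae_regular_count (age_eventE h0 ht) => w rw ha; split=> // -[/= /eqP + za].
  by apply; have /ha := ltW (lt_le_trans hz za); rewrite /h opprB addrC subrK.
Qed.

End poisson_ages.

(** * Reset Brownian motion conditionally on the Poisson process *)

Lemma measurable_fibers d d' (T : measurableType d) (E : measurableType d')
    (X : T -> nat) (f : nat -> T -> E) :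
  (forall n, measurable (X @^-1` [set n])) -> (forall n, measurable_fun setT (f n)) ->
  measurable_fun setT (fun x => f (X x) x).
Proof.
move=> mX mf _ A mA; rewrite setTI.
rewrite (_ : _ @^-1` A = \bigcup_n (X @^-1` [set n] `&` f n @^-1` A)).
  apply: bigcup_measurable => n _; apply: measurableI => //.
  by rewrite -[X in measurable X]setTI; exact: mf.
by apply/seteqP; split => [x Ax|x [n _ [/= -> ]]//]; exists (X x).
Qed.

Lemma integral_prob_cst d (T : measurableType d) (R : realType) (P : probability T R)
    (c : \bar R) : (\int[P]_w c = c)%E.
Proof.
rewrite (_ : (fun=> c) = cst c)// integral_cst//.
by rewrite [X in (_ * X)%E](_ : _ = 1%E) ?mule1//; exact: probability_setT.
Qed.

Section reset_pieces.
Context d (Omega : measurableType d) (R : realType) (P : probability Omega R)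
  (r : R) (N : R -> {RV P >-> nat}) (B : nat -> R -> {RV P >-> R}).
Hypothesis r0 : 0 < r.
Hypothesis hNB : reset_inputs r N B.
Local Notation mu := (@lebesgue_measure R).

Let hN : poisson_process r N := reset_poisson hNB.

(** Joint measurability in time and path is needed because the piece is evaluated at a random age;
    the sampling involves the n-th piece alone, which preserves independence. *)
Definition abs_piece n : R * Omega -> \bar R :=
  rc_version (fun u w => `|B n u w|%:E).

Lemma abs_piece_ge0 n p : (0 <= abs_piece n p)%E.
Proof. by apply: rc_version_ge0 => u w; rewrite lee_fin. Qed.

Lemma measurable_abs_piece n :
  measurable_fun setT (abs_piece n : R * process_space (B n) -> \bar R).
Proof.
apply: measurable_rc_version => t t0; apply/measurable_EFinP.
by apply: measurableT_comp => //; exact: measurable_process.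
Qed.

Lemma measurable_abs_piece_at n a : measurable_fun setT (fun w => abs_piece n (a, w)).
Proof.
apply: (measurableT_comp (@measurable_abs_piece n)
  (g := fun w : Omega => (a, w : process_space (B n)))).
by apply/measurable_fun_pair => //=; exact: measurable_to_process_space.
Qed.

Lemma within_right_continuous (f : R -> R) t : 0 <= t ->
  {within `[0, +oo[, continuous f} -> f u @[u --> t^'+] --> f t.
Proof.
rewrite continuous_within_itvcyP => t0 [cf f0].
move: t0; rewrite le_eqVlt => /predU1P[<-//|t0].
by apply: cvg_at_right_filter; apply: cf; rewrite in_itv/= t0.
Qed.

Lemma abs_pieceE n u w : {within `[0, +oo[, continuous (fun t => B n t w)} -> 0 <= u ->
  abs_piece n (u, w) = `|B n u w|%:E.
Proof.
move=> cB u0; apply: rc_versionE => //; apply: cvg_EFin; first exact: nearW.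
by apply: cvg_norm; exact: within_right_continuous.
Qed.

Lemma ae_abs_pieceE : {ae P, forall w, forall n u, 0 <= u ->
  abs_piece n (u, w) = `|B n u w|%:E}.
Proof.
apply/ae_foralln => n.
apply: filterS (brownian_continuous (reset_brownian hNB n)) => w cB u u0.
exact: abs_pieceE.
Qed.

Lemma abs_piece_moment n a : 0 <= a ->
  (\int[P]_w abs_piece n (a, w) = (Num.sqrt (2 / pi) * Num.sqrt a)%:E)%E.
Proof.
move=> a0; rewrite -(brownian_abs_moment (reset_brownian hNB n))//.
apply: ge0_integral_ae_eq => [w|w|]; rewrite ?abs_piece_ge0 ?lee_fin//.
by apply: filterS ae_abs_pieceE => w ->.
Qed.

Lemma abs_piece_product_moment n a h : 0 <= a -> 0 < h ->
  (\int[P]_w (abs_piece n (a, w) * abs_piece n ((a + h)%R, w)) = (bm_cov h a)%:E)%E.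
Proof.
move=> a0 h0; rewrite -(brownian_product_moment (reset_brownian hNB n))//.
apply: ge0_integral_ae_eq => [w|w|]; rewrite ?mule_ge0 ?abs_piece_ge0 ?lee_fin ?mulr_ge0//.
by apply: filterS ae_abs_pieceE => w hw; rewrite !hw ?addr_ge0 ?(ltW h0)// EFinM.
Qed.

Let idN : {mfun Omega >-> process_space N} := HB.pack (fun w : Omega => w : process_space N)
  (isMeasurableFun.Build _ _ _ _ _ (@measurable_to_process_space _ _ _ _ _ _ N)).

Let idB n : {mfun Omega >-> process_space (B n)} := HB.pack (fun w : Omega => w : process_space (B n))
  (isMeasurableFun.Build _ _ _ _ _ (@measurable_to_process_space _ _ _ _ _ _ (B n))).

(* Conditionally on the Poisson process, two distinct pieces are independent
   copies of Brownian motion. *)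
Lemma conditional_integral n m (E : set (process_space N))
    (G : process_space N * (process_space (B n) * process_space (B m)) -> \bar R) :
  n != m -> measurable E -> measurable_fun setT G -> (forall p, (0 <= G p)%E) ->
  (\int[P]_(w in E) G (w, (w, w)) =
   \int[P]_(w in E) \int[P]_w1 \int[P]_w2 G (w, (w1, w2)))%E.
Proof.
move=> nm mE mG G0.
pose F p := (G p * (\1_E p.1)%:E)%E.
have mF : measurable_fun setT F.
  apply: emeasurable_funM => //; apply/measurable_EFinP.
  by apply: (measurableT_comp (measurable_indic mE)).
have F0 p : (0 <= F p)%E by rewrite mule_ge0.
transitivity (\int[P]_w F (idN w, (idB n w, idB m w)))%E.
  rewrite integral_mkcond; apply: eq_integral => w _.
  by rewrite /F patchE indicE; case: ifPn => wE; rewrite /= ?(mem_set wE) ?mule1 ?mule0.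
transitivity (\int[P]_w \int[P]_w1 \int[P]_w2 F (idN w, (idB n w1, idB m w2)))%E.
  apply: (@independent_triple_integral _ _ _ _ _ _ _ _ _ P idN (idB n) (idB m) F).
  - move=> A C D mA mC mD.
    exact: (mutually_independent3 (reset_independent hNB)
      (i := None) (j := Some n) (k := Some m)).
  - exact: mF.
  - exact: F0.
rewrite [RHS]integral_mkcond; apply: eq_integral => w _.
rewrite patchE /F /= indicE; case: ifPn => wE /=.
  by under eq_integral do under eq_integral do rewrite mule1.
under eq_integral do under eq_integral do rewrite mule0.
under eq_integral do rewrite integral0.
by rewrite integral0.
Qed.

Definition abs_rBM t w : \bar R := abs_piece (N t w) (age N t w, w).

Lemma abs_rBM_ge0 t w : (0 <= abs_rBM t w)%E.
Proof. exact: abs_piece_ge0. Qed.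

Definition regular_path w : Prop := regular_count N w /\
  forall n, {within `[0, +oo[, continuous (fun t => B n t w)}.

Lemma ae_regular_path : {ae P, forall w, regular_path w}.
Proof.
apply: filterS2 (ae_regular_count hN) _ => [w rN cB|]; first by split; [exact: rN|exact: cB].
by apply/ae_foralln => n; exact: brownian_continuous (reset_brownian hNB n).
Qed.

Lemma abs_rBME w t : regular_path w -> 0 <= t -> abs_rBM t w = `|rBM N B t w|%:E.
Proof.
move=> [rN cB] t0; rewrite /abs_rBM abs_pieceE ?age_ge0// age_regular//.
Qed.

(** Just after t the count is still N t, so the same piece runs on from the same reset. Hence a
    second right-continuous sampling, now of the reset process in t, is legitimate. *)
Lemma abs_rBM_right_continuous w t : regular_path w -> 0 <= t ->
  abs_rBM u w @[u --> t^'+] --> abs_rBM t w.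
Proof.
move=> rw t0; have [rN cB] := rw; rewrite abs_rBME//.
set tau := poisson_point N (N t w) w.
have tau_t : 0 <= t - tau by rewrite -age_regular// age_ge0.
apply: (@cvg_trans _ (`|B (N t w) (u - tau) w|%:E @[u --> t^'+])).
  apply: near_eq_cvg; near=> u.
  have tu : t < u by near: u; exact: nbhs_right_gt.
  have Nu : N u w = N t w by near: u; exact: rN.2.
  by rewrite abs_rBME ?(le_trans t0 (ltW tu))// /rBM Nu.
apply: cvg_EFin; first exact: nearW.
apply: cvg_norm; rewrite /rBM -/tau.
apply: (@cvg_comp _ _ _ (fun u => u - tau) (fun v => B (N t w) v w) _ (t - tau)^'+).
  move=> A [e e0 eA]; exists e => // u/= tu ltu; apply: eA; rewrite /= ?ltrD2r//.
  by rewrite opprB addrA subrK.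
exact: within_right_continuous.
Unshelve. all: by end_near. Qed.

Let measurable_piece_at n t : 0 <= t ->
  measurable_fun setT (fun w => abs_piece n (age N t w, w)).
Proof.
move=> t0; apply: (measurableT_comp (@measurable_abs_piece n)
  (g := fun w : Omega => (age N t w, w : process_space (B n)))).
apply/measurable_fun_pair => /=; first exact: measurable_age_Omega.
exact: measurable_to_process_space.
Qed.

Lemma measurable_abs_rBM t : 0 <= t -> measurable_fun setT (abs_rBM t).
Proof.
move=> t0; apply: (@measurable_fibers _ _ _ _ (N t) (fun n w => abs_piece n (age N t w, w))).
  by move=> n; exact: measurable_funPTI.
by move=> n; exact: measurable_piece_at.
Qed.

Lemma integral_abs_rBM t : 0 <= t ->
  (\int[P]_w abs_rBM t w = (Num.sqrt (2 / pi))%:E *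
    \int[mu]_(y in `[0%R, Num.sqrt t]) (expR (- r * y ^+ 2))%:E)%E.
Proof.
move=> t0; rewrite -(integral_sqrt_age r0 hN t0).
have mage := measurable_age_Omega N t0.
have msqrt : measurable_fun setT (fun w => Num.sqrt (age N t w)).
  by apply: measurableT_comp mage; exact: measurable_sqrtr.
rewrite -ge0_integralZl//=; last exact/measurable_EFinP.
apply: (@ge0_integral_fibers _ _ _ _ (N t)) => //.
- by move=> n; exact: measurable_funPTI.
- exact: measurable_abs_rBM.
- by apply: emeasurable_funM => //; exact/measurable_EFinP.
- by move=> w _; exact: abs_rBM_ge0.
move=> n; rewrite setTI.
transitivity (\int[P]_(w in N t @^-1` [set n]) abs_piece n (age N t w, w))%E.
  by apply: eq_integral => w; rewrite inE /abs_rBM => /= ->.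
(* Only piece n occurs; n.+1 merely supplies a second, distinct index. *)
rewrite (@conditional_integral n n.+1 _ (fun p => abs_piece n (age N t p.1, p.2.1))).
- apply: eq_integral => w _ /=.
  under eq_integral do rewrite integral_prob_cst.
  by rewrite abs_piece_moment ?age_ge0// EFinM.
- by rewrite neq_ltn ltnSn.
- by rewrite -[X in measurable X]setTI; apply: measurable_process.
- apply: (measurableT_comp (@measurable_abs_piece n)
    (g := fun p : process_space N * (process_space (B n) * process_space (B n.+1)) => (age N t p.1, p.2.1))).
  apply/measurable_fun_pair => /=.
    exact: (measurableT_comp (@measurable_age _ _ _ P N _ t0) (@measurable_fst _ _ _ _)).
  by apply: (measurableT_comp (@measurable_fst _ _ _ _) (@measurable_snd _ _ _ _)).
- by move=> p; exact: abs_piece_ge0.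
Qed.

End reset_pieces.

(** * Two-time second moments *)

Lemma ge0_integral_ae_eq_in d (T : measurableType d) (R : realType)
    (mu : {measure set T -> \bar R}) (D : set T) (f g : T -> \bar R) :
  (forall x, 0 <= f x)%E -> (forall x, 0 <= g x)%E ->
  {ae mu, forall x, D x -> f x = g x} ->
  (\int[mu]_(x in D) f x = \int[mu]_(x in D) g x)%E.
Proof.
move=> f0 g0 fg; rewrite [LHS]integral_mkcond [RHS]integral_mkcond.
apply: ge0_integral_ae_eq => [x|x|]; [by rewrite patchE; case: ifP..|].
by apply: filterS fg => x fgx; rewrite !patchE; case: ifPn => // /set_mem /fgx.
Qed.

Section second_moment.
Context d (Omega : measurableType d) (R : realType) (P : probability Omega R)
  (r : R) (N : R -> {RV P >-> nat}) (B : nat -> R -> {RV P >-> R}).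
Hypothesis r0 : 0 < r.
Hypothesis hNB : reset_inputs r N B.
Local Notation mu := (@lebesgue_measure R).
Local Notation V := (abs_rBM N B).

Let hN : poisson_process r N := reset_poisson hNB.

Variables (s t : R).
Hypotheses (s0 : 0 <= s) (st : s < t).
Let t0 : 0 <= t := le_trans s0 (ltW st).

Let D1 := [set w | N s w = N t w].
Let D2 := [set w | N s w != N t w].

Let mN u : 0 <= u -> forall n, measurable (N u @^-1` [set n] : set (process_space N)).
Proof. by move=> u0 n; rewrite -[X in measurable X]setTI; exact: measurable_process. Qed.

Let mD1 : measurable (D1 : set (process_space N)).
Proof.
rewrite (_ : D1 = \bigcup_n ((N s @^-1` [set n]) `&` (N t @^-1` [set n]))).
  by apply: bigcup_measurable => k _; apply: measurableI; exact: mN.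
by apply/seteqP; split => [w /= h|w [k _ [/= h k']]]; [exists (N s w)|rewrite /D1/= h k'].
Qed.

Let D2E : D2 = ~` D1.
Proof. by apply/seteqP; split => w /=; [move/eqP|move=> ?; exact/eqP]. Qed.

Let mD2 : measurable (D2 : set (process_space N)).
Proof. by rewrite D2E; exact: measurableC. Qed.

Let mOmega (A : set (process_space N)) : measurable A -> measurable (A : set Omega).
Proof.
move=> mA; have mid := @measurable_to_process_space _ _ _ _ _ _ N.
by rewrite -[X in measurable X]setTI; exact: (mid measurableT A mA).
Qed.

Let measurable_bm_cov (h : R) : 0 < h -> measurable_fun setT (bm_cov h).
Proof.
move=> h0; rewrite /bm_cov; apply: measurable_funM => //; apply: measurable_funD.
  by apply: measurable_funM => //; exact: measurable_sqrtr.
apply: measurable_funM => //; apply: measurableT_comp.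
  by apply: continuous_measurable_fun => ?; exact: continuous_atan.
by apply: measurable_funM => //; exact: measurable_sqrtr.
Qed.

Let bm_cov_ge0 (h a : R) : 0 < h -> 0 <= a -> 0 <= bm_cov h a.
Proof.
move=> h0 a0; rewrite -lee_fin -integral_bm_kernel//.
by apply: integral_ge0 => y _; rewrite lee_fin bm_kernel_ge0.
Qed.

Let mVV D : measurable D -> measurable_fun D (fun w => V s w * V t w)%E.
Proof.
move=> mD; apply: measurable_funTS; apply: emeasurable_funM; exact: measurable_abs_rBM.
Qed.

Let mG n m u v : 0 <= u -> 0 <= v -> measurable_fun setT
  (fun p : process_space N * (process_space (B n) * process_space (B m)) =>
     abs_piece B n (age N u p.1, p.2.1) * abs_piece B m (age N v p.1, p.2.2))%E.
Proof.
move=> u0 v0; apply: emeasurable_funM.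
  apply: (measurableT_comp (@measurable_abs_piece _ _ _ _ _ n)
    (g := fun p : process_space N * (process_space (B n) * process_space (B m)) => (age N u p.1, p.2.1))).
  apply/measurable_fun_pair => /=.
    exact: (measurableT_comp (@measurable_age _ _ _ P N _ u0) (@measurable_fst _ _ _ _)).
  by apply: (measurableT_comp (@measurable_fst _ _ _ _) (@measurable_snd _ _ _ _)).
apply: (measurableT_comp (@measurable_abs_piece _ _ _ _ _ m)
    (g := fun p : process_space N * (process_space (B n) * process_space (B m)) => (age N v p.1, p.2.2))).
apply/measurable_fun_pair => /=.
  exact: (measurableT_comp (@measurable_age _ _ _ P N _ v0) (@measurable_fst _ _ _ _)).
by apply: (measurableT_comp (@measurable_snd _ _ _ _) (@measurable_snd _ _ _ _)).
Qed.

Let mG' n m u v : 0 <= u -> 0 <= v -> measurable_fun setT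
  (fun p : process_space N * (process_space (B n) * process_space (B m)) =>
     abs_piece B n (age N u p.1, p.2.1) * abs_piece B n (age N v p.1, p.2.1))%E.
Proof.
have mGu w : 0 <= w -> measurable_fun setT
  (fun p : process_space N * (process_space (B n) * process_space (B m)) =>
     abs_piece B n (age N w p.1, p.2.1)).
  move=> w0; apply: (measurableT_comp (@measurable_abs_piece _ _ _ _ _ n)
    (g := fun p : process_space N * (process_space (B n) * process_space (B m)) => (age N w p.1, p.2.1))).
  apply/measurable_fun_pair => /=.
    exact: (measurableT_comp (@measurable_age _ _ _ P N _ w0) (@measurable_fst _ _ _ _)).
  by apply: (measurableT_comp (@measurable_fst _ _ _ _) (@measurable_snd _ _ _ _)).
by move=> u0 v0; apply: emeasurable_funM; exact: mGu.
Qed.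

Let D1_age : {ae P, forall w, D1 w -> age N t w = age N s w + (t - s)}.
Proof.
apply: filterS (ae_regular_count hN) => w rw st'.
by rewrite !age_regular// -[N t w]st'; ring.
Qed.

(** Piece n is seen at the ages a and a + (t - s), with product moment [bm_cov (t - s) a]. The
    relation between the ages holds only almost surely, hence the comparison up to a negligible
    set. *)
Let integral_same_piece :
  (\int[P]_(w in D1) (V s w * V t w) =
   \int[mu]_(y in `[0%R, Num.sqrt s]) same_piece_density r (t - s) y)%E.
Proof.
have h0 : 0 < t - s by rewrite subr_gt0.
rewrite -(integral_bm_cov_age r0 hN s0 st).
apply: (@ge0_integral_fibers _ _ _ _ (N s)) => //.
- exact: mOmega.
- by move=> n; exact: measurable_funPTI.
- by apply: mVV; exact: mOmega.
- apply: measurable_funTS; apply/measurable_EFinP.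
  by apply: (measurableT_comp (measurable_bm_cov h0)); exact: measurable_age_Omega.
- by move=> w _; rewrite mule_ge0 ?abs_rBM_ge0.
- by move=> w _; rewrite lee_fin bm_cov_ge0 ?age_ge0.
move=> n.
transitivity (\int[P]_(w in D1 `&` N s @^-1` [set n])
    (abs_piece B n (age N s w, w) * abs_piece B n (age N t w, w)))%E.
  by apply: eq_integral => w; rewrite inE /abs_rBM => -[/= <- ->].
rewrite (@conditional_integral _ _ _ _ _ _ _ hNB n n.+1 _
  (fun p => abs_piece B n (age N s p.1, p.2.1) * abs_piece B n (age N t p.1, p.2.1))%E).
- apply: ge0_integral_ae_eq_in => [w|w|].
  + by do 2![apply: integral_ge0 => ? _]; rewrite mule_ge0 ?abs_piece_ge0.
  + by rewrite lee_fin bm_cov_ge0 ?age_ge0.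
  apply: filterS D1_age => w hw [D1w _]; rewrite /= (hw D1w).
  under eq_integral do rewrite integral_prob_cst.
  by rewrite (abs_piece_product_moment hNB) ?age_ge0.
- by rewrite neq_ltn ltnSn.
- by apply: measurableI => //; exact: mN.
- exact: mG'.
- by move=> p; rewrite mule_ge0 ?abs_piece_ge0.
Qed.

Let integral_new_piece :
  (\int[P]_(w in D2) (V s w * V t w) =
   \int[mu]_(y in `[0%R, Num.sqrt s]) new_piece_density r (t - s) y)%E.
Proof.
have mD2' := mOmega mD2.
have h0 : 0 < t - s by rewrite subr_gt0.
pose A w := Num.sqrt (age N s w) * Num.sqrt (age N t w).
have mA : measurable_fun setT A.
  by apply: measurable_funM; (apply: measurableT_comp;
    [exact: measurable_sqrtr|exact: measurable_age_Omega]).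
have pi0 : (0 <= (2 / pi)%:E :> \bar R)%E by rewrite lee_fin divr_ge0// pi_ge0.
transitivity (\int[P]_(w in D2) ((2 / pi)%:E * (A w)%:E))%E.
  apply: (@ge0_integral_fibers _ _ _ _ (N s)) => //.
  - by move=> n; exact: measurable_funPTI.
  - exact: mVV.
  - by apply: measurable_funTS; apply: emeasurable_funM => //; exact/measurable_EFinP.
  - by move=> w _; rewrite mule_ge0 ?abs_rBM_ge0.
  - by move=> w _; rewrite mule_ge0// lee_fin mulr_ge0 ?sqrtr_ge0.
  move=> n.
  apply: (@ge0_integral_fibers _ _ _ _ (N t)) => //.
  - by apply: measurableI => //; exact: measurable_funPTI.
  - by move=> m; exact: measurable_funPTI.
  - by apply: mVV; apply: measurableI => //; exact: measurable_funPTI.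
  - by apply: measurable_funTS; apply: emeasurable_funM => //; exact/measurable_EFinP.
  - by move=> w _; rewrite mule_ge0 ?abs_rBM_ge0.
  - by move=> w _; rewrite mule_ge0// lee_fin mulr_ge0 ?sqrtr_ge0.
  (* Equal counts are excluded on [D2], so the two pieces are distinct, hence independent. *)
  move=> m; have [<-|nm] := eqVneq n m.
    rewrite (_ : _ `&` _ = set0) ?integral_set0//.
    by apply/seteqP; split => // w [[/eqP]] + /= ns nt; rewrite ns nt.
  transitivity (\int[P]_(w in D2 `&` N s @^-1` [set n] `&` N t @^-1` [set m])
      (abs_piece B n (age N s w, w) * abs_piece B m (age N t w, w)))%E.
    by apply: eq_integral => w; rewrite inE /abs_rBM => -[[_ /= ->] ->].
  rewrite (@conditional_integral _ _ _ _ _ _ _ hNB n m _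
    (fun p => abs_piece B n (age N s p.1, p.2.1) * abs_piece B m (age N t p.1, p.2.2))%E)//.
  - apply: eq_integral => w _ /=.
    transitivity (\int[P]_w1 (abs_piece B n (age N s w, w1) *
        (Num.sqrt (2 / pi) * Num.sqrt (age N t w))%:E))%E.
      apply: eq_integral => w1 _.
      rewrite ge0_integralZl//= ?(abs_piece_moment hNB) ?age_ge0 ?abs_piece_ge0//.
      - exact: measurable_abs_piece_at.
      - by move=> *; exact: abs_piece_ge0.
    rewrite ge0_integralZr//= ?(abs_piece_moment hNB) ?age_ge0//.
    + rewrite -!EFinM; congr EFin; rewrite /A.
      rewrite -[in RHS](@sqr_sqrtr _ (2 / pi)) ?divr_ge0 ?pi_ge0//; ring.
    + exact: measurable_abs_piece_at.
    + by move=> *; exact: abs_piece_ge0.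
  - by apply: measurableI; [apply: measurableI => //|]; exact: mN.
  - exact: mG.
  - by move=> p; rewrite mule_ge0 ?abs_piece_ge0.
rewrite ge0_integralZl//=; last 2 first.
- by apply: measurable_funTS; exact/measurable_EFinP.
- by move=> w _; rewrite lee_fin mulr_ge0 ?sqrtr_ge0.
rewrite (integral_sqrt_ages r0 hN s0 st) integral_survival_defect ?(ltW h0)//.
pose c : \bar R := (\int[mu]_(z in `[0%R, (t - s)%R]) (r * Num.sqrt z * expR (- r * z))%:E)%E.
have c0 : (0 <= c)%E.
  by apply: integral_ge0 => z _; rewrite lee_fin !mulr_ge0 ?expR_ge0// ltW.
have mgauss : measurable_fun setT (fun y : R => (expR (- r * y ^+ 2))%:E).
  by apply: measurable_continuous_EFin; exact: continuous_gauss_rate.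
transitivity (\int[mu]_(y in `[0%R, Num.sqrt s]) ((2 / pi * expR (- r * y ^+ 2))%:E * c))%E; last by [].
rewrite (_ : (\int[mu]_(b in `[0%R, (t - s)%R]) _)%E = c)// muleA.
move: c c0 => c c0.
rewrite -ge0_integralZl//=; last exact: measurable_funTS.
rewrite -ge0_integralZr//=.
- by apply: measurable_funTS; exact: emeasurable_funM.
- by move=> y _; rewrite mule_ge0// lee_fin expR_ge0.
Qed.

Lemma integral_abs_rBM_product :
  (\int[P]_w (V s w * V t w) =
   \int[mu]_(y in `[0%R, Num.sqrt s]) second_moment_density r (t - s) y)%E.
Proof.
have mD1' := mOmega mD1; have mD2' := mOmega mD2.
have D12 : D1 `|` D2 = setT by rewrite D2E setUv.
have md (F : R * R -> \bar R) : measurable_fun setT F ->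
    measurable_fun `[0, Num.sqrt s]%classic (fun y => F (y, t - s)).
  move=> mF; apply: measurable_funTS.
  by apply: (measurableT_comp mF (g := fun y => (y, t - s))); exact/measurable_fun_pair.
rewrite -D12 ge0_integral_setU//; last 3 first.
- by rewrite D12; exact: mVV.
- by move=> w _; rewrite mule_ge0 ?abs_rBM_ge0.
- by rewrite D2E; apply/disj_setPCl.
rewrite integral_same_piece integral_new_piece -ge0_integralD//.
- by move=> y _; exact: same_piece_density_ge0.
- exact: (md _ (measurable_same_piece_density r)).
- by move=> y _; exact: new_piece_density_ge0.
- exact: (md _ (measurable_new_piece_density r0)).
Qed.

End second_moment.

(** * Moments of the area *)

Section symmetric_square.
Context {R : realType}.
Local Notation mu := (@lebesgue_measure R).

Lemma mule2e (x : \bar R) : (2%:E * x = x + x)%E.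
Proof. exact: (mule_natl x 2). Qed.

(** The square is cut along s = t; exchanging the variables carries the part s > t onto the other
    one, up to the negligible diagonal. *)
Lemma integral_square_symmetric (F : R * R -> \bar R) (T : R) :
  measurable_fun setT F -> (forall p, (0 <= F p)%E) ->
  (forall s t, F (s, t) = F (t, s)) ->
  (\int[mu]_(t in `[0%R, T]) \int[mu]_(s in `[0%R, T]) F (s, t) =
   2%:E * \int[mu]_(t in `[0%R, T]) \int[mu]_(s in `[0%R, t]) F (s, t))%E.
Proof.
move=> mF F0 FC.
have mF1 t (D : set R) : measurable_fun D (fun s => F (s, t)).
  by apply: measurable_funTS; apply: (measurableT_comp mF (g := fun s => (s, t))); exact/measurable_fun_pair.
pose A t := (\int[mu]_(s in `[0%R, t]) F (s, t))%E.
pose C t := (\int[mu]_(s in `]t, T]) F (s, t))%E.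
have mB (b : R -> R -> bool) : measurable_fun setT (fun p : R * R => b p.1 p.2) ->
    measurable [set p : R * R | [set y | b p.1 y] p.2].
  by move=> mb; exact: measurable_set_bool.
have A0 t : (0 <= A t)%E by apply: integral_ge0 => s _.
have C0 t : (0 <= C t)%E by apply: integral_ge0 => s _.
have mFs : measurable_fun setT (fun p : R * R => F (p.2, p.1)).
  by apply: (measurableT_comp mF (g := fun p : R * R => (p.2, p.1))); exact/measurable_fun_pair.
have mA : measurable_fun setT A.
  apply: (@measurable_integral_section _ _ _ _ _ mu (fun t : R => `[0%R, t]%classic)
    (fun p : R * R => F (p.2, p.1))) => //.
  apply: (mB (fun t s => s \in `[0, t])).
  under eq_fun do rewrite in_itv/=.
  by apply: measurable_and; apply: measurable_fun_ler.
have mC : measurable_fun setT C.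
  apply: (@measurable_integral_section _ _ _ _ _ mu (fun t : R => `]t, T]%classic)
    (fun p : R * R => F (p.2, p.1))) => //.
  apply: (mB (fun t s => s \in `]t, T])).
  under eq_fun do rewrite in_itv/=.
  by apply: measurable_and; [apply: measurable_fun_ltr|apply: measurable_fun_ler].
transitivity (\int[mu]_(t in `[0%R, T]) (A t + C t))%E.
  apply: eq_integral => t; rewrite inE/= in_itv/= => /andP[t0 tT].
  rewrite (_ : `[0, T]%classic = `[0, t]%classic `|` `]t, T]%classic :> set R).
    rewrite ge0_integral_setU//; first exact: mF1.
    apply/disj_setPS => s [] /=; rewrite !in_itv/= => /andP[_ st] /andP[ts _].
    by have := le_lt_trans st ts; rewrite ltxx.
  apply/seteqP; split => s /=; rewrite !in_itv/=.
    by move=> /andP[-> ->]; rewrite andbT; case: (leP s t) => _; [left|right].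
  by case=> /andP[h1 h2]; apply/andP; split=> //;
     [exact: le_trans tT|exact: le_trans t0 (ltW h1)].
rewrite ge0_integralD//; [|exact: measurable_funTS..].
rewrite mule2e.
suff -> : (\int[mu]_(t in `[0%R, T]) C t = \int[mu]_(t in `[0%R, T]) A t)%E by [].
transitivity (\int[mu]_(s in `[0%R, T]) \int[mu]_(t in `[0%R, s[) F (s, t))%E; last first.
  apply: eq_integral => s _; rewrite integral_itv_bndo_bndc.
    by apply: eq_integral => t _; rewrite FC.
  rewrite (_ : (fun t => F (s, t)) = (fun t => F (t, s)))//.
  by apply/funext => t; rewrite FC.
apply: (@tonelli_swap _ _ _ _ _ mu mu `[0%R, T]%classic (fun t : R => `]t, T]%classic)
  `[0%R, T]%classic (fun s : R => `[0%R, s[%classic) (fun p : R * R => F (p.2, p.1))).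
- move=> t s /=; rewrite !in_itv/=; split.
    by move=> [/andP[t0 tT] /andP[ts sT]]; rewrite t0 ts sT (le_trans t0 (ltW ts)).
  by move=> [/andP[s0 sT] /andP[t0 ts]]; rewrite t0 ts sT (le_trans (ltW ts) sT).
- apply: measurable_set_bool2; under eq_fun do rewrite !in_itv/=.
  apply: measurable_and; apply: measurable_and;
    [apply: measurable_fun_ler|apply: measurable_fun_ler
    |apply: measurable_fun_ltr|apply: measurable_fun_ler] => //.
- exact: mFs.
- by move=> p; exact: F0.
Qed.

End symmetric_square.

Section area_moments.
Context d (Omega : measurableType d) (R : realType) (P : probability Omega R)
  (r T : R) (N : R -> {RV P >-> nat}) (B : nat -> R -> {RV P >-> R}).
Hypotheses (r0 : 0 < r) (T0 : 0 < T).
Hypothesis hNB : reset_inputs r N B.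
Local Notation mu := (@lebesgue_measure R).

(* Jointly measurable in time and [w], unlike [rBM] itself. *)
Definition joint_abs_rBM : R * Omega -> \bar R := rc_version (abs_rBM N B).

Lemma joint_abs_rBM_ge0 p : (0 <= joint_abs_rBM p)%E.
Proof. by apply: rc_version_ge0 => t w; exact: abs_rBM_ge0. Qed.

Lemma measurable_joint_abs_rBM : measurable_fun setT joint_abs_rBM.
Proof. by apply: measurable_rc_version => t t0; exact: measurable_abs_rBM. Qed.

Lemma joint_abs_rBME w t : regular_path N B w -> 0 <= t ->
  joint_abs_rBM (t, w) = abs_rBM N B t w.
Proof. by move=> rw t0; apply: rc_versionE => //; exact: abs_rBM_right_continuous. Qed.

Definition area (w : Omega) : \bar R :=
  (\int[mu]_(t in `[0%R, T]) joint_abs_rBM (t, w))%E.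

Lemma area_ge0 w : (0 <= area w)%E.
Proof. by apply: integral_ge0 => t _; exact: joint_abs_rBM_ge0. Qed.

Let mZ : measurable_fun setT (fun p : Omega * R => joint_abs_rBM (p.2, p.1)).
Proof.
apply: (measurableT_comp measurable_joint_abs_rBM (g := fun p : Omega * R => (p.2, p.1))).
exact/measurable_fun_pair.
Qed.

Let mZt t : measurable_fun setT (fun w => joint_abs_rBM (t, w)).
Proof.
apply: (measurableT_comp measurable_joint_abs_rBM (g := fun w : Omega => (t, w))).
exact/measurable_fun_pair.
Qed.

Let mZw w : measurable_fun setT (fun t => joint_abs_rBM (t, w)).
Proof.
apply: (measurableT_comp measurable_joint_abs_rBM (g := fun t : R => (t, w))).
exact/measurable_fun_pair.
Qed.

Lemma measurable_area : measurable_fun setT area.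
Proof.
apply: (@measurable_integral_section _ _ _ _ _ mu (fun _ : Omega => `[0%R, T]%classic)
  (fun p : Omega * R => joint_abs_rBM (p.2, p.1))) => //.
- rewrite (_ : mkset _ = snd @^-1` `[0, T]%classic)//.
  by rewrite -[X in measurable X]setTI; exact: measurable_snd.
- by move=> p; exact: joint_abs_rBM_ge0.
Qed.

Let swap (f : Omega * R -> \bar R) : measurable_fun setT f -> (forall p, (0 <= f p)%E) ->
  (\int[P]_w \int[mu]_(t in `[0%R, T]) f (w, t) =
   \int[mu]_(t in `[0%R, T]) \int[P]_w f (w, t))%E.
Proof.
move=> mf f0.
apply: (@tonelli_swap _ _ _ _ _ P mu setT (fun _ : Omega => `[0%R, T]%classic)
  `[0%R, T]%classic (fun _ : R => setT) f) => //.
- by move=> w t; split=> -[].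
- rewrite (_ : mkset _ = snd @^-1` `[0, T]%classic); last first.
    by apply/seteqP; split => p //= [].
  by rewrite -[X in measurable X]setTI; exact: measurable_snd.
Qed.

Lemma integral_area : (\int[P]_w area w = (T `^ (3 / 2) * f1 (r * T))%:E)%E.
Proof.
rewrite (swap mZ) => [|p]; last exact: joint_abs_rBM_ge0.
rewrite -(integral_mean r0 T0); apply: eq_integral => t.
rewrite inE/= in_itv/= => /andP[t0 _].
rewrite -(integral_abs_rBM r0 hNB t0).
apply: ge0_integral_ae_eq => [w|w|].
- exact: joint_abs_rBM_ge0.
- exact: abs_rBM_ge0.
by apply: filterS (ae_regular_path hNB) => w rw; rewrite joint_abs_rBME.
Qed.

Let M (p : R * R) : \bar R := (\int[P]_w (joint_abs_rBM (p.1, w) * joint_abs_rBM (p.2, w)))%E.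

Let M_ge0 p : (0 <= M p)%E.
Proof. by apply: integral_ge0 => w _; rewrite mule_ge0 ?joint_abs_rBM_ge0. Qed.

Let measurable_M : measurable_fun setT M.
Proof.
apply: (@measurable_integral_section _ _ _ _ _ P (fun _ : R * R => setT)
  (fun p : (R * R) * Omega => joint_abs_rBM (p.1.1, p.2) * joint_abs_rBM (p.1.2, p.2))%E).
- by rewrite (_ : mkset _ = setT).
- apply: emeasurable_funM.
    apply: (measurableT_comp measurable_joint_abs_rBM
      (g := fun p : (R * R) * Omega => (p.1.1, p.2))).
    apply/measurable_fun_pair => //=.
    exact: (measurableT_comp (@measurable_fst _ _ _ _) (@measurable_fst _ _ _ _)).
  apply: (measurableT_comp measurable_joint_abs_rBM
      (g := fun p : (R * R) * Omega => (p.1.2, p.2))).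
  apply/measurable_fun_pair => //=.
  exact: (measurableT_comp (@measurable_snd _ _ _ _) (@measurable_fst _ _ _ _)).
- by move=> p; rewrite mule_ge0 ?joint_abs_rBM_ge0.
Qed.

(** The square of the area is a double time integral whose mean is that of [M]; by symmetry it is
    twice the integral over s <= t, which turns 8 r^3 into 4 r^3. *)
Lemma integral_area_sqr : (\int[P]_w (area w * area w) =
  ((2 * (r * T) ^+ 2 + r * T - 6 + (5 * (r * T) + 6) * expR (- (r * T)))
     / (4 * r ^+ 3))%:E)%E.
Proof.
transitivity (\int[mu]_(t in `[0%R, T]) \int[mu]_(s in `[0%R, T]) M (s, t))%E.
  transitivity (\int[P]_w \int[mu]_(t in `[0%R, T]) (area w * joint_abs_rBM (t, w)))%E.
    apply: eq_integral => w _; rewrite ge0_integralZl//.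
    - by apply: measurable_funTS; exact: mZw.
    - by move=> t _; exact: joint_abs_rBM_ge0.
    - exact: area_ge0.
  rewrite (swap (f := fun p => area p.1 * joint_abs_rBM (p.2, p.1))%E).
  - apply: eq_integral => t _.
    transitivity (\int[P]_w \int[mu]_(s in `[0%R, T])
      (joint_abs_rBM (s, w) * joint_abs_rBM (t, w)))%E.
      apply: eq_integral => w _; rewrite ge0_integralZr//.
      - by apply: measurable_funTS; exact: mZw.
      - by move=> s _; exact: joint_abs_rBM_ge0.
      - exact: joint_abs_rBM_ge0.
    rewrite (swap (f := fun p => joint_abs_rBM (p.2, p.1) * joint_abs_rBM (t, p.1))%E)//.
    + apply: emeasurable_funM; first exact: mZ.
      exact: (measurableT_comp (mZt t) (@measurable_fst _ _ Omega R)).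
    + by move=> p; rewrite mule_ge0 ?joint_abs_rBM_ge0.
  - apply: emeasurable_funM; last exact: mZ.
    exact: (measurableT_comp measurable_area (@measurable_fst _ _ Omega R)).
  - by move=> p; rewrite mule_ge0 ?area_ge0 ?joint_abs_rBM_ge0.
have MC s t : M (s, t) = M (t, s).
  rewrite /M/=.
  apply: eq_integral => w _.
  exact: muleC.
rewrite (integral_square_symmetric T measurable_M M_ge0 MC).
rewrite (_ : _ / (4 * r ^+ 3) = 2 * ((2 * (r * T) ^+ 2 + r * T - 6 + (5 * (r * T) + 6) * expR (- (r * T)))
     / (8 * r ^+ 3))); last by field; rewrite gt_eqF.
rewrite [RHS]EFinM -(integral_second_moment_triangle r0 (ltW T0)).
suff -> : (\int[mu]_(t in `[0%R, T]) \int[mu]_(s in `[0%R, t]) M (s, t) =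
  \int[mu]_(t in `[0%R, T]) \int[mu]_(s in `[0%R, t])
    \int[mu]_(y in `[0%R, Num.sqrt s]) second_moment_density r (t - s) y)%E by [].
apply: eq_integral => t _.
apply: ge0_integral_ae_eq_in => [s|s|].
- exact: M_ge0.
- by apply: integral_ge0 => y _; exact: second_moment_density_ge0.
(* The two-time moment is known for s < t only; the point s = t is negligible. *)
have : {ae mu, forall s, s != t}.
  exists [set t]; split => //; first exact: lebesgue_measure_set1.
  by move=> s /= /negP; rewrite negbK => /eqP.
apply: filterS => s st; rewrite /= in_itv/= => /andP[s0].
rewrite le_eqVlt (negbTE st)/= => {}st.
rewrite -(integral_abs_rBM_product r0 hNB s0 st).
apply: ge0_integral_ae_eq => [w|w|].
- by rewrite mule_ge0 ?joint_abs_rBM_ge0.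
- by rewrite mule_ge0 ?abs_rBM_ge0.
apply: filterS (ae_regular_path hNB) => w rw.
by rewrite !joint_abs_rBME// (le_trans s0 (ltW st)).
Qed.

(** The finite mean already computed makes the extended area finite almost surely, so that [fine]
    loses nothing. *)
Lemma ae_absolute_area : {ae P, forall w,
  absolute_area (rBM N B) T w = fine (area w) /\ area w \is a fin_num}.
Proof.
have iarea : P.-integrable setT area.
  apply/integrableP; split; first exact: measurable_area.
  under eq_integral do rewrite gee0_abs ?area_ge0//.
  by rewrite integral_area ltry.
have fin := integrable_ae measurableT iarea.
apply: filterS2 (ae_regular_path hNB) fin => w rw fw; split; last exact: fw.
rewrite /absolute_area /Rintegral; congr fine; apply: eq_integral => t.
rewrite inE/= in_itv/= => /andP[t0 _].
by rewrite joint_abs_rBME// abs_rBME.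
Qed.

End area_moments.

(** * From the version to expectation and variance *)

Section moments.
Context d (Omega : measurableType d) (R : realType) (P : probability Omega R).

(* [X] need not be measurable: only a version [A] of it is. *)
Lemma expectation_variance_version (X : Omega -> R) (A : Omega -> \bar R) (m M : R) :
  measurable_fun setT A -> (forall w, (0 <= A w)%E) -> (forall w, 0 <= X w) ->
  {ae P, forall w, X w = fine (A w) /\ A w \is a fin_num} ->
  (\int[P]_w A w = m%:E)%E -> (\int[P]_w (A w * A w) = M%:E)%E ->
  'E_P[X]%E = m%:E /\ 'V_P[X]%E = (M - m ^+ 2)%:E.
Proof.
move=> mA A0 X0 XA EA EAA.
pose Y w := fine (A w).
have mY : measurable_fun setT Y by exact: measurableT_comp.
have Y0 w : 0 <= Y w by exact: fine_ge0.
have EY : (\int[P]_w (Y w)%:E = m%:E)%E.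
  rewrite -EA; apply: ge0_integral_ae_eq => //.
  by apply: filterS XA => w [_ fA]; rewrite fineK.
have EYY : (\int[P]_w (Y w ^+ 2)%:E = M%:E)%E.
  rewrite -EAA; apply: ge0_integral_ae_eq => [w|w|].
  - by rewrite lee_fin sqr_ge0.
  - by rewrite mule_ge0.
  by apply: filterS XA => w [_ fA]; rewrite expr2 EFinM fineK.
have EX : 'E_P[X]%E = m%:E.
  rewrite unlock -EY; apply: ge0_integral_ae_eq => //.
  by apply: filterS XA => w [-> _].
have m0 : 0 <= m by rewrite -lee_fin -EA; exact: integral_ge0.
split=> //; rewrite /variance unlock EX/= unlock.
pose J := (\int[P]_w ((Y w - m) ^+ 2)%:E)%E.
transitivity J.
  apply: ge0_integral_ae_eq => [w|w|].
  - by rewrite lee_fin/= -expr2 sqr_ge0.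
  - by rewrite lee_fin sqr_ge0.
  apply: filterS XA => w [Xw _].
  transitivity ((X w - m) * (X w - m))%:E; first by [].
  by rewrite Xw expr2.
have mYm : measurable_fun setT (fun w => ((Y w - m) ^+ 2)%:E).
  by apply/measurable_EFinP; apply: measurable_funX; exact: measurable_funB.
have mY2 : measurable_fun setT (fun w => (Y w ^+ 2)%:E).
  by apply/measurable_EFinP; exact: measurable_funX.
have mYE : measurable_fun setT (fun w => (Y w)%:E) by exact/measurable_EFinP.
(* The expansion of (Y - m)^2 is rearranged as (Y - m)^2 + 2 m Y = Y^2 + m^2, all terms nonnegative,
   so additivity needs no integrability. The identity also shows that J is finite. *)
have : (J + (2 * m)%:E * m%:E = M%:E + (m ^+ 2)%:E)%E.
  rewrite -{1}EY -ge0_integralZl//; last by rewrite lee_fin mulr_ge0.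
  rewrite -ge0_integralD//; last 3 first.
  - by move=> w _; rewrite lee_fin sqr_ge0.
  - by move=> w _; rewrite lee_fin mulr_ge0// mulr_ge0.
  - exact: emeasurable_funM.
  rewrite -EYY -(integral_prob_cst P (m ^+ 2)%:E) -ge0_integralD//; last 2 first.
  - by move=> w _; rewrite lee_fin sqr_ge0.
  - by move=> w _; rewrite lee_fin sqr_ge0.
  - by apply: eq_integral => w _; rewrite -!EFinM -!EFinD; congr EFin; ring.
  - by move=> w _; rewrite lee_fin.
have J0 : (0 <= J)%E by apply: integral_ge0 => w _; rewrite lee_fin sqr_ge0.
case: J J0 => [j| |] //.
rewrite -EFinM -!EFinD => _ [jE]; congr EFin.
by rewrite -(addrK (2 * m * m) j) jE; ring.
Qed.

End moments.

(** With rho = r T, the bracket squared in [f2] is [f1] times sqrt(2 pi) 2 rho^(3/2), which yields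
    the prefactor 1 / (8 pi rho^3); the other term uses T^3 / rho^3 = 1 / r^3. *)
Lemma second_moment_sub_sqr_mean (R : realType) (r T : R) : 0 < r -> 0 < T ->
  (2 * (r * T) ^+ 2 + r * T - 6 + (5 * (r * T) + 6) * expR (- (r * T))) / (4 * r ^+ 3)
    - (T `^ (3 / 2) * f1 (r * T)) ^+ 2 = T ^+ 3 * f2 (r * T).
Proof.
move=> r0 T0; rewrite powR_three_halves ?(ltW T0)// /f1 /f2.
rewrite powR_three_halves; last by rewrite mulr_ge0 ?ltW.
have p0 : 0 < pi :> R := pi_gt0 R.
rewrite (sqrtrM pi (ler0n R 2)) (sqrtrM T (ltW r0)).
have hr := sqr_sqrtr (ltW r0); have hT := sqr_sqrtr (ltW T0).
have hp := sqr_sqrtr (ltW p0); have h2 : Num.sqrt 2 ^+ 2 = 2 :> R by exact: sqr_sqrtr.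
have sr : Num.sqrt r != 0 by rewrite gt_eqF// sqrtr_gt0.
have sT : Num.sqrt T != 0 by rewrite gt_eqF// sqrtr_gt0.
have sp : Num.sqrt pi != 0 :> R by rewrite gt_eqF// sqrtr_gt0.
have s2 : Num.sqrt 2 != 0 :> R by rewrite gt_eqF// sqrtr_gt0.
move: (expR _) (erf _) => e E.
have key (x y : R) :
    (x * (1 / (Num.sqrt 2 * Num.sqrt pi) * y)) ^+ 2 = (x * y) ^+ 2 / (2 * pi).
  by rewrite -{2}h2 -{2}hp; field; rewrite s2 sp.
rewrite key.
move: (Num.sqrt r) (Num.sqrt T) (Num.sqrt pi) hr hT hp sr sT sp => a b c hr hT hp a0 b0 c0.
rewrite -hr -hT -hp; field.
by rewrite a0 b0 c0.
Qed.

Theorem theorem6p1 (R : realType) (d : measure_display)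
  (Omega : measurableType d) (P : probability Omega R) (r T : R)
  (N : R -> {RV P >-> nat}) (B : nat -> R -> {RV P >-> R})
  (hr : 0 < r) (hT : 0 < T) (hNB : reset_inputs r N B) :
  'E_P[absolute_area (rBM N B) T]%E = (T `^ (3 / 2) * f1 (r * T))%:E /\
  'V_P[absolute_area (rBM N B) T]%E = (T ^+ 3 * f2 (r * T))%:E.
Proof.
rewrite -second_moment_sub_sqr_mean//.
apply: (@expectation_variance_version _ _ _ P _ (area T N B)).
- exact: measurable_area.
- exact: area_ge0.
- by move=> w; apply: Rintegral_ge0 => t _.
- exact: (ae_absolute_area hr hT hNB).
- exact: (integral_area hr hT hNB).
- exact: (integral_area_sqr hr hT hNB).
Qed.
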